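(* Let $d\geq 1$ be an integer, let $R_0(w)\in\mathbb{C}[w]$ be any polynomial of degree $d$ with only simple zeros, and let $P(z,w)\in\mathbb{C}[z,w]$ be any polynomial of total degree at most $d$. For $\delta\geq 0$ let $F_\delta: z\to w$ be the holomorphic correspondence on $\hat{\mathbb{C}}\times\hat{\mathbb{C}}$ defined by $R_0(w)+\delta P(z,w)=0$. Then for any $\epsilon>0$ there is $\Delta>0$ (depending on $R_0$, $P$ and $\epsilon$) such that if $|\delta|<\Delta$, there is a probability measure $\mu_{F_\delta}$ on $\hat{\mathbb{C}}$ with $(F_\delta)_*(\mu_{F_\delta})=d\,\mu_{F_\delta}$ such that for any $a\in\mathbb{C}$, $$\frac{1}{d^m}(F_\delta^m)_*(\delta_a)\longrightarrow \mu_{F_\delta}\quad\text{in the weak-* topology as } m\to\infty,$$ and the support $\operatorname{supp}\mu_{F_\delta}$ is contained in the $\epsilon$-neighborhood of the set of zeros of $R_0$. Moreover, $\operatorname{supp}\mu_{F_\delta}$ is the minimal closed subset of $\hat{\mathbb{C}}$ that is forward invariant under $F_\delta$ and contains a point of $\mathbb{C}$.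
   Context: $\hat{\mathbb{C}}=\mathbb{C}\cup\{\infty\}$ is the Riemann sphere. ''Measure'' means regular Borel measure, and $\delta_a$ (with $a$ a point) is the Dirac measure at $a$ (not to be confused with the parameter $\delta$). Holomorphic correspondence: for a polynomial $G(z,w)$ let $\overline{\Gamma_G}$ be the compactification (closure) in $\hat{\mathbb{C}}\times\hat{\mathbb{C}}$ of the curve $\{(z,w)\in\mathbb{C}^2: G(z,w)=0\}$. The correspondence defined by $G=0$ is the multivalued map $F(z)=\{w\in\hat{\mathbb{C}}:(z,w)\in\overline{\Gamma_G}\}$. Points of $F(a)$ are counted with multiplicity: for $a\in\mathbb{C}$ they are the roots in $w$ of $G(a,w)$, and for $a=\infty$ the roots in $w$ of the coefficient in $G$ of the highest power of $z$; in each case $\infty$ is counted with multiplicity equal to $\deg_w G$ minus the number of finite roots. If $G$ does not depend on $z$, $F$ is the constant correspondence sending every point to the zeros of $G$. For $|\delta|$ sufficiently small, $\deg_w(R_0(w)+\delta P(z,w))=d$, and $d$ is called the degree of $F_\delta$. Pushforward: for a finite measure $\mu$ on $\hat{\mathbb{C}}$, $F_*(\mu)$ is the measure with $\langle F_*\mu,\phi\rangle=\int \sum_{w\in F(z)}\phi(w)\,d\mu(z)$ for $\phi\in C(\hat{\mathbb{C}})$, counting multiplicities; in particular $F_*\delta_a=\sum_{w\in F(a)}\delta_w$. $F^m$ is the $m$-fold iterate, with multiplicities, so that $(F^m)_*=(F_* )^m$. A set $S\subset\hat{\mathbb{C}}$ is forward invariant under $F$ if $F(S)\subset S$. The minimal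 set with a property $\mathcal{P}$ is a nonempty set $S_0$ with property $\mathcal{P}$ such that $S_0\subset S_1$ for every set $S_1$ with property $\mathcal{P}$. *)

(* Defs.v *)
From HB Require Import structures.
From mathcomp Require Import all_boot all_order all_algebra.
From mathcomp Require Import polyXY complex.
From mathcomp Require Import all_classical all_reals all_analysis.
From mathcomp Require Import measurable_realfun.

Set Implicit Arguments.
Unset Strict Implicit.
Unset Printing Implicit Defensive.

Import Order.TTheory GRing.Theory Num.Theory.
Import numFieldNormedType.Exports.

Local Open Scope classical_set_scope.
Local Open Scope ring_scope.
Local Open Scope complex_scope.

(* The complex numbers are [R[i]], normed over themselves (hence [R[i]^o]);
   on the sphere, [Some z] is the finite point [z] and [None] is infinity. *)
Definition sphere (R : realType) : Type := one_point_compactification R[i]^o.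

HB.instance Definition _ (R : realType) := Topological.copy (sphere R)
  (one_point_compactification R[i]^o).
HB.instance Definition _ (R : realType) := Pointed.copy (sphere R)
  (one_point_compactification R[i]^o).
HB.instance Definition _ (R : realType) := Measurable.copy (sphere R)
  (g_sigma_algebraType (open : set (set (sphere R)))).

Definition fin_pt (R : realType) (z : R[i]) : sphere R := Some z.
Definition infty_pt (R : realType) : sphere R := None.
Arguments infty_pt {R}.

(* A polynomial G(z, w) is [G : {poly {poly R[i]}}] with z the outer and w the
   inner variable: G(z, w) = [G.[z, w]], and [G`_i`_j] is the coefficient of
   z^i w^j. *)
Definition total_degree_le (R : realType) (G : {poly {poly R[i]}}) (d : nat) :=
  forall i j : nat, G`_i`_j != 0 -> (i + j <= d)%N.

Definition graph (R : realType) (G : {poly {poly R[i]}}) :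
    set (sphere R * sphere R) :=
  closure [set p | exists z w : R[i],
                     p = (fin_pt z, fin_pt w) /\ G.[z, w] = 0].

Definition corr (R : realType) (G : {poly {poly R[i]}}) (z : sphere R) :
    set (sphere R) :=
  [set w | graph G (z, w)].

Definition forward_invariant (R : realType) (G : {poly {poly R[i]}})
    (S : set (sphere R)) : Prop :=
  \bigcup_(z in S) corr G z `<=` S.

Definition poly_roots (R : realType) (p : {poly R[i]}) : seq R[i] :=
  sval (closed_field_poly_normal p).

(* G(a, w) as a polynomial in w for finite a; for a = infinity, the coefficient
   in G of the highest power of z. *)
Definition fiber_poly (R : realType) (G : {poly {poly R[i]}}) (a : sphere R) :
    {poly R[i]} :=
  if a is Some z then G.[z%:P] else lead_coef G.

(* The points of F(a), repeated according to multiplicity (the order is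
   irrelevant); [(sizeY G).-1] is the degree of G in w. *)
Definition corr_mult (R : realType) (G : {poly {poly R[i]}}) (a : sphere R) :
    seq (sphere R) :=
  let r := poly_roots (fiber_poly G a) in
  map (@fin_pt R) r ++ nseq ((sizeY G).-1 - size r) infty_pt.

(* m-fold iterate of a multivalued map, with multiplicities. *)
Fixpoint mv_iter (T : Type) (F : T -> seq T) (m : nat) (a : T) : seq T :=
  if m is m'.+1 then flatten [seq F w | w <- mv_iter F m' a] else [:: a].

(* [nu] is F_* mu.  Real test functions suffice by linearity, and for finite
   measures nu is determined by this identity. *)
Definition is_pushforward (R : realType) (F : sphere R -> seq (sphere R))
    (mu nu : {measure set (sphere R) -> \bar R}) : Prop :=
  forall phi : sphere R -> R, continuous phi ->
    (\int[nu]_w (phi w)%:E = \int[mu]_z (\sum_(w <- F z) phi w)%:E)%E.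

(* The sum of the Dirac measures at the entries of [s]. *)
Definition sum_dirac (R : realType) (s : seq (sphere R)) :
    {measure set (sphere R) -> \bar R} :=
  msum (fun i => dirac (nth infty_pt s i)) (size s).

Definition weak_star_cvg (R : realType)
    (mu_ : nat -> {measure set (sphere R) -> \bar R})
    (mu : {measure set (sphere R) -> \bar R}) : Prop :=
  forall phi : sphere R -> R, continuous phi ->
    (\int[mu_ m]_z (phi z)%:E)%E @[m --> \oo] --> (\int[mu]_z (phi z)%:E)%E.

Definition regular_measure (R : realType)
    (mu : {measure set (sphere R) -> \bar R}) : Prop :=
  forall A : set (sphere R), measurable A ->
    mu A = ereal_inf [set mu U | U in [set U | open U /\ A `<=` U]] /\
    mu A = ereal_sup [set mu K | K in [set K | compact K /\ K `<=` A]].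

Definition msupport (R : realType)
    (mu : {measure set (sphere R) -> \bar R}) : set (sphere R) :=
  [set z | forall U : set (sphere R), open U -> U z -> (0 < mu U)%E].

(* Euclidean neighbourhood in the finite plane.  The zero set being finite,
   quantifying over all eps gives the same notion for the chordal metric. *)
Definition zeros_nbhd (R : realType) (p : {poly R[i]}) (eps : R) :
    set (sphere R) :=
  [set fin_pt z | z in [set z : R[i] |
                    exists2 r : R[i], root p r & `|z - r| < eps%:C]].

Definition minimal_set (T : Type) (Pr : set T -> Prop) (S0 : set T) : Prop :=
  [/\ S0 !=set0, Pr S0 & forall S1 : set T, Pr S1 -> S0 `<=` S1].

(* R_0(w) + delta P(z, w). *)
Definition corr_family (R : realType) (R0 : {poly R[i]})
    (P : {poly {poly R[i]}}) (delta : R) : {poly {poly R[i]}} :=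
  R0%:P + (delta%:C)%:P *: P.

Lemma continuous_sphere_measurable (R : realType) (phi : sphere R -> R) :
  continuous phi -> measurable_fun setT phi.
Proof.
move=> /continuousP cphi.
apply: (measurability (@RGenOpens.G R)).
  exact: measurable_realfun.RGenOpens.measurableE.
move=> _ [_ [a [b ->] <-]].
rewrite setTI; apply: sub_sigma_algebra; apply: cphi.
exact: interval_open.
Qed.

Lemma integral_sum_dirac (R : realType) (s : seq (sphere R))
    (phi : sphere R -> R) : continuous phi ->
  (\int[sum_dirac s]_w (phi w)%:E = (\sum_(w <- s) phi w)%:E)%E.
Proof.
move=> cphi; have mphi := continuous_sphere_measurable cphi.
have mE : measurable_fun setT (fun w => (phi w)%:E) by exact/measurable_EFinP.
rewrite integralE !ge0_integral_measure_sum//; last 2 first.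
- exact: measurable_funeneg.
- exact: measurable_funepos.
have -> : (\sum_(i < size s) \int[dirac (nth infty_pt s i)]_x
    (fun w => (phi w)%:E)^\+ x = (\sum_(w <- s) phi^\+ w)%:E)%E.
  rewrite (big_nth infty_pt) big_mkord -sumEFin; apply: eq_bigr => i _.
  have mf := measurable_funepos mE.
  by rewrite integral_dirac// diracT mul1e funeposE /funrpos EFin_max ?EFinN.
have -> : (\sum_(i < size s) \int[dirac (nth infty_pt s i)]_x
    (fun w => (phi w)%:E)^\- x = (\sum_(w <- s) phi^\- w)%:E)%E.
  rewrite (big_nth infty_pt) big_mkord -sumEFin; apply: eq_bigr => i _.
  have mf := measurable_funeneg mE.
  by rewrite integral_dirac// diracT mul1e funenegE /funrneg EFin_max ?EFinN.
rewrite -EFinB -sumrB; congr EFin; apply: eq_bigr => w _.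
by rewrite -[in RHS](funrposBneg phi).
Qed.

(* Main.v *)
(* For small delta, G(z, w) = 0 has, over the disk |z| < rho, exactly d roots
   w = f_i(z), one near each simple zero r_i of R_0, and each f_i is a
   1/2-contraction; every other orbit enters the disk because a root satisfies
   |w| <= |z|/2 or |w| < rho.  So F_delta is an iterated function system with
   equal weights.  Its self-similar measure mu is the law of
   lim_m f_(i_1) o ... o f_(i_m), where i_1, i_2, ... are the base-d digits of a
   uniform random number in [0, 1]; this avoids Riesz representation, gives
   weak-* convergence by dominated convergence, and transfers the regularity of
   the Lebesgue measure to mu. *)
From HB Require Import structures.
Require Import Defs.
From mathcomp Require Import all_boot all_order all_algebra.
From mathcomp Require Import polyXY complex.
From mathcomp Require Import all_classical all_reals all_analysis.
From mathcomp Require Import measurable_realfun.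
From mathcomp Require Import lra ring.

Set Implicit Arguments.
Unset Strict Implicit.
Unset Printing Implicit Defensive.

Import Order.TTheory GRing.Theory Num.Theory.
Import numFieldNormedType.Exports.
Import ComplexField.Normc.
Import HBNNSimple.

Local Open Scope classical_set_scope.
Local Open Scope ring_scope.
Local Open Scope complex_scope.

(** * Moduli and polynomial bounds *)

(** The branches are controlled only over the disk, and so is the sum of a test function over F(z).
    The measure is therefore built inside the disk, and a starting point outside is iterated until
    its whole orbit has entered, after a time that depends on the point. The most significant digit
    is the outermost branch. Lengthening a word then changes only the innermost starting point,
    whose influence the contraction kills; prepending a digit composes one more branch on the
    outside, which yields forward invariance of the support. Invariance of mu is read off the limit
    itself: applying F once more to an orbit average only shifts the time. The coding map can be
    discontinuous only at d-adic rationals. Compact parameter sets that avoid this null set have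
    compact images, and this is how regularity is carried over. Since the set-valued correspondence
    is a closure, it must also be checked that over finite points the closure adds neither infinity
    nor a point off the curve. *)

Section ComplexModulus.
Context {R : realType}.
Implicit Types (x y z : R[i]).

Lemma normcD x y : normc (x + y) <= normc x + normc y.
Proof. exact: le_normcD. Qed.

Lemma normcB x y : normc (x - y) = normc (y - x).
Proof. by rewrite -opprB normcN. Qed.

Lemma normc_ge0 x : 0 <= normc x.
Proof. by case: x => a b; rewrite sqrtr_ge0. Qed.

Lemma normc_triangle y x z : normc (x - z) <= normc (x - y) + normc (y - z).
Proof. by rewrite -[x - z](subrKA y) normcD. Qed.

Lemma normcX x n : normc (x ^+ n) = normc x ^+ n.
Proof.
by elim: n => [|n IH]; rewrite ?expr0 ?normc1// !exprS normcM IH.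
Qed.

Lemma normc_gt0 x : (0 < normc x) = (x != 0).
Proof.
rewrite lt_def normc_ge0 andbT; apply/idP/idP; apply: contra => /eqP.
  by move=> ->; rewrite normc0.
by move/eq0_normc => ->.
Qed.

Lemma normc_real (a : R) : normc (a%:C) = `|a|.
Proof. by rewrite /= expr0n/= addr0 sqrtr_sqr. Qed.

Lemma normc_prod (I : Type) (s : seq I) (f : I -> R[i]) :
  normc (\prod_(i <- s) f i) = \prod_(i <- s) normc (f i).
Proof.
by elim: s => [|i s IH]; rewrite ?(big_nil, big_cons) ?normc1 ?normcM ?IH.
Qed.

Lemma normc_sum (I : Type) (s : seq I) (f : I -> R[i]) :
  normc (\sum_(i <- s) f i) <= \sum_(i <- s) normc (f i).
Proof.
elim: s => [|i s IH]; rewrite ?(big_nil, big_cons) ?normc0//.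
exact: le_trans (normcD _ _) (lerD (lexx _) IH).
Qed.

End ComplexModulus.

Section PolynomialBounds.
Context {R : realType}.
Implicit Types (p : {poly R[i]}) (P : {poly {poly R[i]}}).

(** A single constant bounds both the values and the slopes, because the inductive step needs both:
    the increment of p X + c is p(x) (x - y) + (p(x) - p(y)) y. *)
Lemma poly_lipschitz p (rho : R) : exists2 C : R, 0 <= C &
  forall x y, normc x <= rho -> normc y <= rho ->
    normc p.[x] <= C /\ normc (p.[x] - p.[y]) <= C * normc (x - y).
Proof.
elim/poly_ind: p => [|p c [C C0 H]].
  by exists 0 => // x y _ _; rewrite !horner0 subrr normc0 mul0r.
have [rho0|rho0] := leP 0 rho; last first.
  exists 0 => // x y xr; have := normc_ge0 x; lra.
exists (C * rho + C + normc c).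
  by rewrite !addr_ge0 ?mulr_ge0 ?normc_ge0.
move=> x y xr yr; have [Hx Hxy] := H x y xr yr.
rewrite !hornerMXaddC; split.
  apply: le_trans (normcD _ _) _; rewrite normcM.
  have := ler_pM (normc_ge0 _) (normc_ge0 _) Hx xr; lra.
have -> : p.[x] * x + c - (p.[y] * y + c)
  = p.[x] * (x - y) + (p.[x] - p.[y]) * y by ring.
apply: le_trans (normcD _ _) _; rewrite !normcM.
have h1 := ler_wpM2r (normc_ge0 (x - y)) Hx.
have h2 := ler_pM (normc_ge0 _) (normc_ge0 _) Hxy yr.
have h3 := mulr_ge0 (normc_ge0 c) (normc_ge0 (x - y)).
by rewrite !mulrDl; lra.
Qed.

Lemma poly2_lipschitz P (rho : R) : exists2 C : R, 0 <= C &
  forall z w z' w', normc z <= rho -> normc w <= rho ->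
    normc z' <= rho -> normc w' <= rho ->
    normc P.[z, w] <= C /\
    normc (P.[z, w] - P.[z', w']) <= C * (normc (z - z') + normc (w - w')).
Proof.
elim/poly_ind: P => [|P c [C C0 H]].
  by exists 0 => // z w z' w' *; rewrite !horner0 subrr normc0 mul0r.
have [rho0|rho0] := leP 0 rho; last first.
  exists 0 => // z w z' w' xr; have := normc_ge0 z; lra.
have [D D0 K] := poly_lipschitz c rho.
exists (C * rho + C + D); first by rewrite !addr_ge0 ?mulr_ge0.
move=> z w z' w' zr wr z'r w'r; have [Hx Hxy] := H _ _ _ _ zr wr z'r w'r.
have [Kx Kxy] := K _ _ wr w'r.
rewrite !hornerMXaddC !hornerD !hornerM !hornerC; split.
  apply: le_trans (normcD _ _) _; rewrite normcM.
  have := ler_pM (normc_ge0 _) (normc_ge0 _) Hx zr; lra.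
have -> : P.[z, w] * z + c.[w] - (P.[z', w'] * z' + c.[w'])
  = P.[z, w] * (z - z') + (P.[z, w] - P.[z', w']) * z' + (c.[w] - c.[w']).
  by ring.
apply: le_trans (normcD _ _) _.
apply: le_trans (lerD (normcD _ _) (lexx _)) _; rewrite !normcM.
have h1 := ler_wpM2r (normc_ge0 (z - z')) Hx.
have h2 := ler_pM (normc_ge0 _) (normc_ge0 _) Hxy z'r.
have h3 := mulr_ge0 D0 (normc_ge0 (z - z')).
have h4 := mulr_ge0 C0 (normc_ge0 (w - w')).
by rewrite !mulrDl !mulrDr; rewrite !mulrDr !mulrDl in h2; lra.
Qed.

Lemma poly2_coef P z w :
  P.[z, w] = \sum_(i < size P) \sum_(j < size P`_i) P`_i`_j * w ^+ j * z ^+ i.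
Proof.
rewrite (horner_coef P) horner_sum; apply: eq_bigr => i _.
by rewrite -polyC_exp hornerM hornerC horner_coef mulr_suml.
Qed.

(** With A the sum of the moduli of the coefficients, M >= 1 bounds each monomial by M^d. This lets
    delta P be compared with R_0, which also grows like a d-th power. *)
Lemma total_degree_growth P d : total_degree_le P d ->
  exists2 A : R, 0 <= A & forall z w (M : R),
    1 <= M -> normc z <= M -> normc w <= M -> normc P.[z, w] <= A * M ^+ d.
Proof.
move=> degP.
exists (\sum_(i < size P) \sum_(j < size P`_i) normc P`_i`_j).
  by apply: sumr_ge0 => i _; apply: sumr_ge0 => j _; apply: normc_ge0.
move=> z w M M1 zM wM; rewrite poly2_coef mulr_suml.
apply: le_trans; [exact: normc_sum|apply: ler_sum => i _; rewrite mulr_suml].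
apply: le_trans; [exact: normc_sum|apply: ler_sum => j _].
rewrite !normcM !normcX.
have [->|nz] := eqVneq P`_i`_j 0; first by rewrite normc0 !mul0r.
rewrite -mulrA ler_wpM2l ?normc_ge0//.
apply: (@le_trans _ _ (M ^+ j * M ^+ i)).
  by rewrite ler_pM ?exprn_ge0 ?normc_ge0// lerXn2r ?nnegrE ?normc_ge0
    ?(le_trans ler01).
by rewrite -exprD ler_weXn2l// addnC degP.
Qed.

End PolynomialBounds.

(** * Inverse branches near the zeros *)

(** Asking for the property at all smaller scales allows a minimum over finitely many zeros, and
    later a further shrinking below 1 and below eps. *)
Lemma common_scale {R : realType} (T : eqType) (s : seq T)
    (Q : T -> R -> Prop) :
  (forall x, x \in s -> exists2 e0, 0 < e0 & forall e, 0 < e <= e0 -> Q x e) ->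
  exists2 e0, 0 < e0 & forall e, 0 < e <= e0 -> forall x, x \in s -> Q x e.
Proof.
elim: s => [_|x s IH H]; first by exists 1.
have [e0 e0_gt0 He0] := H x (mem_head x s).
have [|e1 e1_gt0 He1] := IH; first by move=> y ys; apply: H;
  rewrite in_cons ys orbT.
exists (Num.min e0 e1); first by rewrite lt_min e0_gt0.
move=> e; rewrite le_min => /and3P[e_gt0 ee0 ee1] y.
rewrite in_cons => /predU1P[->|ys]; first by apply: He0; rewrite e_gt0.
by apply: He1 => //; rewrite e_gt0.
Qed.

Section Perturbation.
Context {R : realType} (d : nat) (R0 : {poly R[i]}) (P : {poly {poly R[i]}}).
Hypotheses (degR0 : size R0 = d.+1)
  (simpleR0 : forall r : R[i], root R0 r -> mup r R0 = 1%N)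
  (degP : total_degree_le P d).

Let R0_neq0 : R0 != 0. Proof. by rewrite -size_poly_gt0 degR0. Qed.

(* Write R_0 = (X - r) q with q(r) <> 0. *)
Lemma simple_root_expanding r : root R0 r ->
  exists2 e0 : R, 0 < e0 & forall e, 0 < e <= e0 ->
    forall w w', normc (w - r) <= e -> normc (w' - r) <= e ->
      e * normc (w - w') <= normc (R0.[w] - R0.[w']).
Proof.
move=> rr; have [q qE] : exists q, R0 = q * ('X - r%:P) by apply/factor_theorem.
have qr : q.[r] != 0.
  apply/negP => /eqP qr0; have [q' q'E] : exists q', q = q' * ('X - r%:P).
    by apply/factor_theorem/eqP.
  suff : (1 < mup r R0)%N by rewrite simpleR0.
  by rewrite mup_geq// qE q'E expr2 -mulrA dvdp_mull.
have [L L0 HL] := poly_lipschitz q (normc r + 1).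
pose k := normc q.[r].
have k_gt0 : 0 < k by rewrite normc_gt0.
(* Replacing q(w) by q(r) costs L e, and so does the variation of q between w and w'. What remains
   is k - 2 L e, which is at least e when e (2 L + 1) <= k. *)
exists (Num.min 1 (k / (2 * L + 1))).
  by rewrite lt_min ltr01 divr_gt0// ltr_wpDl ?mulr_ge0.
move=> e; rewrite le_min ler_pdivlMr ?ltr_wpDl ?mulr_ge0// => /and3P[e0 e1 ek].
have ball w : normc (w - r) <= e -> normc w <= normc r + 1.
  by move=> wr; have := normcD (w - r) r; rewrite subrK; lra.
move=> w w' wr w'r.
have rball : normc r <= normc r + 1 by rewrite lerDl.
have [_ h1] := HL w r (ball _ wr) rball.
have [_ h2] := HL w w' (ball _ wr) (ball _ w'r).
rewrite qE !hornerM !hornerXsubC.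
have -> : q.[w] * (w - r) - q.[w'] * (w' - r) =
   q.[w] * (w - w') - (q.[w'] - q.[w]) * (w' - r) by ring.
have h3 := normcD (q.[w] * (w - w') - (q.[w'] - q.[w]) * (w' - r))
   ((q.[w'] - q.[w]) * (w' - r)).
rewrite subrK !normcM normcB in h3.
have h5 : k <= normc q.[w] + L * e.
  have := normcD q.[w] (q.[r] - q.[w]); rewrite addrC subrK -/k normcB => h.
  by have := ler_wpM2l L0 wr; lra.
have h6 := ler_pM (normc_ge0 _) (normc_ge0 _) h2 w'r.
have h7 := ler_wpM2r (normc_ge0 (w - w')) h5.
have h8 := ler_wpM2r (normc_ge0 (w - w')) ek.
rewrite [normc (q.[w'] - _)]normcB in h3.
rewrite -normcB in h3.
rewrite !mulrDl !mulrDr !mulrDl in h8.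
rewrite !mulrDl in h7.
by move: h3 h6 h7 h8; lra.
Qed.

Let c := lead_coef R0.
Let rs := poly_roots R0.

Lemma poly_rootsE (p : {poly R[i]}) :
  p = lead_coef p *: \prod_(z <- poly_roots p) ('X - z%:P).
Proof. exact: svalP (closed_field_poly_normal p). Qed.

Lemma mem_poly_roots (p : {poly R[i]}) z :
  p != 0 -> (z \in poly_roots p) = root p z.
Proof.
move=> p0; rewrite [in RHS](poly_rootsE p) rootZ ?lead_coef_eq0//.
by rewrite root_prod_XsubC.
Qed.

Lemma size_poly_roots (p : {poly R[i]}) : p != 0 ->
  size (poly_roots p) = (size p).-1.
Proof.
move=> p0; rewrite [in RHS](poly_rootsE p) size_scale ?lead_coef_eq0//.
by rewrite size_prod_XsubC.
Qed.

Lemma normc_horner_roots (p : {poly R[i]}) w :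
  normc p.[w] = normc (lead_coef p) * \prod_(z <- poly_roots p) normc (w - z).
Proof.
rewrite [in LHS](poly_rootsE p) hornerZ normcM horner_prod normc_prod.
by congr (_ * _); apply: eq_bigr => z _; rewrite hornerXsubC.
Qed.

Lemma uniq_poly_roots_simple : uniq rs.
Proof.
apply: count_mem_uniq => x; rewrite mem_poly_roots//.
have : mup x R0 = count_mem x rs.
  rewrite [in LHS](poly_rootsE R0) -mul_polyC mupMr ?mu_prod_XsubC//.
  by rewrite rootC lead_coef_eq0.
move=> <-; have [/simpleR0 ->//|rx] := boolP (root R0 x).
by rewrite mupNroot.
Qed.

Variable delta : R.
Hypothesis delta_ge0 : 0 <= delta.
Let G := corr_family R0 P delta.

Lemma corr_family_coef i j : G`_i`_j = (R0%:P)`_i`_j + delta%:C * P`_i`_j.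
Proof. by rewrite coefD coefZ coefD coefCM. Qed.

Lemma corr_family_horner z : G.[z%:P] = R0 + delta%:C *: P.[z%:P].
Proof. by rewrite hornerD hornerZ hornerC mul_polyC. Qed.

Lemma corr_family_horner2 z w : G.[z, w] = R0.[w] + delta%:C * P.[z, w].
Proof. by rewrite corr_family_horner hornerD hornerZ. Qed.

Lemma corr_family_sizeY : (sizeY G <= d.+1)%N.
Proof.
apply/bigmax_leqP => i _; apply/leq_sizeP => j dj.
rewrite corr_family_coef coefC.
have -> : P`_i`_j = 0.
  apply: contraTeq dj => /degP ij; rewrite -ltnNge ltnS.
  by rewrite (leq_trans _ ij)// leq_addl.
rewrite mulr0 addr0; case: ifP => _; last by rewrite coef0.
by rewrite nth_default// degR0.
Qed.

Hypothesis delta_lead : delta * normc P`_0`_d < normc c / 2.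

(** A monomial z^i w^d of total degree at most d has i = 0, so the coefficient of w^d does not
    depend on z. With [delta_lead] it stays away from 0, and every finite fiber has degree exactly
    d. *)
Lemma fiber_coef z : (G.[z%:P])`_d = c + delta%:C * P`_0`_d.
Proof.
rewrite corr_family_horner coefD coefZ /c lead_coefE degR0; congr (_ + _ * _).
rewrite horner_coef coef_sum.
have [->|P0] := eqVneq P 0; first by rewrite size_poly0 big_ord0 !coef0.
rewrite -size_poly_gt0 in P0; rewrite (bigD1 (Ordinal P0))//= big1 ?addr0.
  by rewrite expr0 mulr1.
move=> i; rewrite -val_eqE /= -lt0n => i0.
rewrite -polyC_exp coefMC; have [->|] := eqVneq P`_i`_d 0;
  first by rewrite mul0r.
by move=> /degP; rewrite -[leqRHS]add0n leq_add2r leqNgt i0.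
Qed.

Lemma fiber_coef_normc z : normc c / 2 <= normc (G.[z%:P])`_d.
Proof.
rewrite fiber_coef.
have := normcD (c + delta%:C * P`_0`_d) (- (delta%:C * P`_0`_d)).
rewrite addrK normcN normcM normc_real ger0_norm//.
by move: delta_lead; lra.
Qed.

Let normc_c_gt0 : 0 < normc c. Proof. by rewrite normc_gt0 lead_coef_eq0. Qed.

Lemma fiber_size z : size G.[z%:P] = d.+1.
Proof.
apply/eqP; rewrite eqn_leq; apply/andP; split; last first.
  rewrite ltnNge; apply/negP => /leq_sizeP/(_ _ (leqnn d)) h.
  have := fiber_coef_normc z; rewrite h normc0.
  by move: normc_c_gt0; lra.
rewrite corr_family_horner (leq_trans (size_polyD _ _))// geq_max degR0 leqnn.
rewrite (leq_trans (size_scale_leq _ _))//; apply/leq_sizeP => j dj.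
rewrite horner_coef coef_sum big1// => i _; rewrite -polyC_exp coefMC.
have [->|/degP ij] := eqVneq P`_i`_j 0; first by rewrite mul0r.
by move: (leq_trans dj (leq_trans (leq_addl i j) ij)); rewrite ltnn.
Qed.

Lemma fiber_neq0 z : G.[z%:P] != 0.
Proof. by rewrite -size_poly_gt0 fiber_size. Qed.

(** The fiber already has d roots while the degree of G in w is at most d, so the truncated
    subtraction leaves no copy of infinity. *)
Lemma corr_mult_fin z :
  corr_mult G (fin_pt z) = map (@fin_pt R) (poly_roots G.[z%:P]).
Proof.
rewrite /corr_mult /= size_poly_roots ?fiber_neq0// fiber_size /=.
have : ((sizeY G).-1 - d = 0)%N.
  by apply/eqP; rewrite subn_eq0 -subn1 leq_subLR add1n corr_family_sizeY.
by move=> ->; rewrite cats0.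
Qed.

End Perturbation.

Lemma prodr_ge_expr (F : realDomainType) (T : eqType) (s : seq T) (f : T -> F)
    (a : F) :
  0 <= a -> (forall x, x \in s -> a <= f x) ->
  a ^+ size s <= \prod_(x <- s) f x.
Proof.
move=> a0; elim: s => [|x s IH] H; first by rewrite big_nil.
rewrite big_cons exprS ler_pM ?exprn_ge0//; first exact: H (mem_head _ _).
by apply: IH => y ys; apply: H; rewrite in_cons ys orbT.
Qed.

Section Branches.
Context {R : realType} (d : nat) (R0 : {poly R[i]}) (P : {poly {poly R[i]}}).
Hypotheses (degR0 : size R0 = d.+1)
  (simpleR0 : forall r : R[i], root R0 r -> mup r R0 = 1%N)
  (degP : total_degree_le P d).

Let rs := poly_roots R0.
Let c := lead_coef R0.
Let R0_neq0 : R0 != 0. Proof. by rewrite -size_poly_gt0 degR0. Qed.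
Let c_gt0 : 0 < normc c. Proof. by rewrite normc_gt0 lead_coef_eq0. Qed.
Let size_rs : size rs = d. Proof. by rewrite size_poly_roots// degR0. Qed.

(* If |w| >= roots_radius then |w - r| >= |w|/2 for every zero r. *)
Definition roots_radius : R := 2 * (\sum_(r <- rs) normc r) + 2.
Let rho := roots_radius.

Lemma roots_radius_ge2 : 2 <= rho.
Proof.
by rewrite /rho /roots_radius lerDr mulr_ge0// sumr_ge0// => r _;
  apply: normc_ge0.
Qed.

Lemma root_lt_radius r : r \in rs -> 2 * normc r + 2 <= rho.
Proof.
move=> rrs; rewrite /rho /roots_radius (big_rem r)//= lerD2r ler_pM2l// lerDl.
by apply: sumr_ge0 => *; apply: normc_ge0.
Qed.

Section Fixed.
Variables (A C e delta : R).
Hypothesis delta_ge0 : 0 <= delta.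
Hypothesis growthA : forall z w (M : R),
  1 <= M -> normc z <= M -> normc w <= M -> normc P.[z, w] <= A * M ^+ d.
Hypothesis lipC : forall z w z' w', normc z <= rho -> normc w <= rho ->
    normc z' <= rho -> normc w' <= rho ->
    normc P.[z, w] <= C /\
    normc (P.[z, w] - P.[z', w']) <= C * (normc (z - z') + normc (w - w')).
Hypotheses (e_gt0 : 0 < e) (e_le1 : e <= 1).
Hypothesis expanding : forall r, r \in rs -> forall w w',
  normc (w - r) <= e -> normc (w' - r) <= e ->
  e * normc (w - w') <= normc (R0.[w] - R0.[w']).
Hypotheses (delta1 : delta * normc P`_0`_d < normc c / 2)
  (delta2 : delta * (A * 2 ^+ d) < normc c / 2 ^+ d)
  (delta3 : delta * C < normc c / 2 * (e / 2) ^+ d)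
  (delta4 : delta * C < e / 3).

Let G := corr_family R0 P delta.

(** At a root with |w| >= rho and |z| < 2 |w|, the modulus of R_0(w) is at least |c| (|w|/2)^d,
    whereas delta P(z, w) is at most delta A (2 |w|)^d. The powers of |w| cancel and [delta2] is
    contradicted. *)
Lemma root_escape z w : G.[z, w] = 0 -> normc w <= normc z / 2 \/ normc w < rho.
Proof.
move=> Gzw; have [|zw] := leP (normc w) (normc z / 2); first by left.
right; rewrite ltNge; apply/negP => rhow.
have w1 : 1 <= normc w by have := roots_radius_ge2; lra.
have h1 : normc P.[z, w] <= A * (2 * normc w) ^+ d by apply: growthA; lra.
have h2 : normc c * (normc w / 2) ^+ d <= normc R0.[w].
  rewrite normc_horner_roots ler_wpM2l ?normc_ge0// -size_rs.
  apply: prodr_ge_expr => [|r /root_lt_radius rr]; first lra.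
  by have := normcD (w - r) r; rewrite subrK; lra.
have h3 : R0.[w] = - (delta%:C * P.[z, w]).
  by apply/eqP; rewrite -addr_eq0 -corr_family_horner2 Gzw.
have h4 : normc R0.[w] <= delta * (A * 2 ^+ d) * normc w ^+ d.
  rewrite h3 normcN normcM normc_real ger0_norm// -mulrA ler_wpM2l//.
  by rewrite -mulrA -exprMn.
have h5 : normc c / 2 ^+ d * normc w ^+ d <= delta * (A * 2 ^+ d) * normc w ^+
  d.
  by rewrite (le_trans _ h4)// (le_trans _ h2)// expr_div_n mulrAC mulrA.
by move: h5; rewrite ler_pM2r ?exprn_gt0// ?leNgt ?delta2//; lra.
Qed.

(* For |z| >= rho the root may not exist; [branch] is then [rs`_i]. *)
Definition branch (i : nat) (z : R[i]) : R[i] :=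
  xget rs`_i [set w | root G.[z%:P] w /\ normc (w - rs`_i) <= e / 2].

Lemma branch_near i z : normc (branch i z - rs`_i) <= e / 2.
Proof.
rewrite /branch; case: xgetP => [w _ [//]|_].
by rewrite subrr normc0 divr_ge0 ?ltW.
Qed.

Lemma near_root_le r w :
  r \in rs -> normc (w - r) <= e / 2 -> normc w <= rho - 1.
Proof.
move=> /root_lt_radius rr wr; have := normcD (w - r) r; rewrite subrK.
by have := normc_ge0 r; move: e_gt0 e_le1; lra.
Qed.

(** The margin 1 below rho keeps limits of branch values strictly inside the open disk. *)
Lemma branch_le i z : (i < d)%N -> normc (branch i z) <= rho - 1.
Proof.
move=> id; apply: (@near_root_le rs`_i); last exact: branch_near.
by rewrite mem_nth ?size_rs.
Qed.

Lemma branch_lt i z : (i < d)%N -> normc (branch i z) < rho.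
Proof. by move=> /branch_le/le_lt_trans; apply; rewrite gtrBl. Qed.

(* |G(z, r_i)| = |delta P(z, r_i)| is small, while it equals, up to the leading
   coefficient, the product of the distances from r_i to the roots of G(z, .);
   so some root is close to r_i. *)
Lemma branch_root i z : (i < d)%N -> normc z < rho ->
  root G.[z%:P] (branch i z).
Proof.
move=> id zrho; rewrite /branch; case: xgetP => [w _ [//]|H]; exfalso.
have irs : rs`_i \in rs by rewrite mem_nth ?size_rs.
have Ri : root R0 rs`_i by rewrite -mem_poly_roots.
have Gz := fiber_neq0 degR0 degP delta_ge0 delta1 z.
have lc : normc c / 2 <= normc (lead_coef G.[z%:P]).
  by rewrite lead_coefE (fiber_size degR0 degP delta_ge0 delta1)/=
    fiber_coef_normc.
have h1 : normc G.[z, rs`_i] <= delta * C.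
  rewrite corr_family_horner2 (rootP Ri) add0r normcM normc_real.
  rewrite ger0_norm// ler_wpM2l//.
  have ir : normc rs`_i <= rho by have := root_lt_radius irs;
    have := normc_ge0 rs`_i; lra.
  by have [] := lipC (ltW zrho) ir (ltW zrho) ir.
have h2 : normc c / 2 * (e / 2) ^+ d <= normc G.[z, rs`_i].
  rewrite normc_horner_roots.
  have -> : d = size (poly_roots G.[z%:P]).
    by rewrite size_poly_roots// (fiber_size degR0 degP delta_ge0 delta1).
  have e2 : 0 <= e / 2 by rewrite divr_ge0 ?ltW.
  apply: ler_pM => //; [by rewrite divr_ge0 ?normc_ge0|exact: exprn_ge0|apply:
    prodr_ge_expr => // w].
  rewrite mem_poly_roots// => rw; rewrite leNgt; apply/negP => wr.
  by apply: (H w); split=> //; rewrite normcB ltW.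
by move: delta3; rewrite ltNge (le_trans h2).
Qed.

(** Subtracting the equations at z and z' equates the increment of R_0 with that of -delta P.
    Expansion of the former and the Lipschitz bound on the latter give |w - w'| <= (|z - z'| + |w -
    w'|) / 3, hence the factor 1/2. *)
Lemma branch_contraction i z z' : (i < d)%N ->
  normc z < rho -> normc z' < rho ->
  normc (branch i z - branch i z') <= normc (z - z') / 2.
Proof.
move=> id zr z'r.
have irs : rs`_i \in rs by rewrite mem_nth ?size_rs.
set w := branch i z; set w' := branch i z'.
have he : e / 2 <= e by move: e_gt0; lra.
have h1 := expanding irs (le_trans (branch_near i z) he)
  (le_trans (branch_near i z') he).
have [_ h2] := lipC (ltW zr) (ltW (branch_lt z id)) (ltW z'r) (ltW (branch_lt
  z' id)).
have : R0.[w] - R0.[w'] = - (delta%:C * (P.[z, w] - P.[z', w'])).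
  have /rootP := branch_root id zr; have /rootP := branch_root id z'r.
  rewrite !corr_family_horner2 => /eqP + /eqP.
  by rewrite !addr_eq0 => /eqP -> /eqP ->; ring.
move=> RE; move: h1; rewrite RE normcN normcM normc_real ger0_norm// => h1.
have := ler_wpM2l delta_ge0 h2; rewrite mulrA => h3.
have h4 := ler_wpM2r (addr_ge0 (normc_ge0 (z - z')) (normc_ge0 (w - w'))) (ltW
  delta4).
have : e * normc (w - w') <= e / 3 * (normc (z - z') + normc (w - w')).
  exact: le_trans h1 (le_trans h3 h4).
have -> : e / 3 * (normc (z - z') + normc (w - w'))
   = e * ((normc (z - z') + normc (w - w')) / 3) by field.
by rewrite ler_pM2l//; lra.
Qed.

(* Expansion at scale e, twice the radius of the disks around the zeros, also
   separates these disks, as R_0 vanishes at both centres. *)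
Lemma branch_inj i j z :
  (i < d)%N -> (j < d)%N -> branch i z = branch j z -> i = j.
Proof.
move=> id jd ij.
have irs : rs`_i \in rs by rewrite mem_nth ?size_rs.
have jrs : rs`_j \in rs by rewrite mem_nth ?size_rs.
have Ri : root R0 rs`_i by rewrite -mem_poly_roots.
have Rj : root R0 rs`_j by rewrite -mem_poly_roots.
have := expanding irs (w := rs`_i) (w' := rs`_j).
rewrite subrr normc0 (rootP Ri) (rootP Rj) subrr normc0 => /(_ (ltW e_gt0)).
have h : normc (rs`_j - rs`_i) <= e.
  apply: le_trans (normc_triangle (branch i z) _ _) _.
  have := branch_near i z; have := branch_near j z; rewrite -ij normcB; lra.
move=> /(_ h); rewrite pmulr_rle0// => ij0.
have : rs`_i == rs`_j.
  by rewrite -subr_eq0 -[_ == _]negbK -normc_gt0 -leNgt.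
by rewrite nth_uniq ?size_rs ?(uniq_poly_roots_simple degR0 simpleR0)// => /eqP.
Qed.

(** The branch values are d distinct roots of a polynomial of degree d, so they exhaust its roots
    and all multiplicities are 1. *)
Lemma fiber_roots_branch z : normc z < rho ->
  perm_eq (poly_roots G.[z%:P]) [seq branch i z | i <- iota 0 d].
Proof.
move=> zr; rewrite perm_sym.
have Gz := fiber_neq0 degR0 degP delta_ge0 delta1 z.
have u : uniq [seq branch i z | i <- iota 0 d].
  rewrite map_inj_in_uniq ?iota_uniq// => i j; rewrite !mem_iota !add0n.
  exact: branch_inj.
have s : {subset [seq branch i z | i <- iota 0 d] <= poly_roots G.[z%:P]}.
  move=> _ /mapP[i + ->]; rewrite mem_iota add0n /= => id.
  by rewrite mem_poly_roots// branch_root.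
have sz : (size (poly_roots G.[z%:P]) <= size [seq branch i z | i <- iota 0
  d])%N.
  by rewrite size_map size_iota size_poly_roots// (fiber_size degR0 degP
    delta_ge0 delta1).
have [_ E] := uniq_min_size u s sz.
apply: uniq_perm => //; exact: (leq_size_uniq u s sz).
Qed.

End Fixed.

(** This collects what the dynamical part needs from the algebra. The radius rho is fixed before
    delta, and the distance eps / 2 leaves room for passing to limits of branch values. *)
Lemma contracting_branches (eps : R) : 0 < eps ->
  exists rho Delta : R, [/\ 1 < rho, 0 < Delta &
  forall delta, 0 <= delta -> `|delta| < Delta ->
  let G := corr_family R0 P delta in
  exists f : nat -> R[i] -> R[i],
  [/\ forall i z, (i < d)%N -> normc (f i z) <= rho - 1 /\
        exists2 r, root R0 r & normc (f i z - r) <= eps / 2,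
      forall i z z', (i < d)%N -> normc z < rho -> normc z' < rho ->
        normc (f i z - f i z') <= normc (z - z') / 2,
      forall z, normc z < rho ->
        perm_eq (corr_mult G (fin_pt z)) [seq fin_pt (f i z) | i <- iota 0 d],
      forall z, exists2 s : seq R[i],
        corr_mult G (fin_pt z) = map (@fin_pt R) s &
        size s = d /\ forall w, (w \in s) = (G.[z, w] == 0) &
      forall z w, G.[z, w] = 0 -> normc w <= normc z / 2 \/ normc w < rho]].
Proof.
move=> eps_gt0; exists rho.
have [A A0 growthA] := total_degree_growth degP.
have [C C0 lipC] := poly2_lipschitz P rho.
have [e0 e0_gt0 He0] := @common_scale R _ rs (fun r e => forall w w',
    normc (w - r) <= e -> normc (w' - r) <= e ->
    e * normc (w - w') <= normc (R0.[w] - R0.[w']))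
  (fun r rrs => @simple_root_expanding R d R0 degR0 simpleR0 r
    (etrans (esym (mem_poly_roots r R0_neq0)) rrs)).
pose e := Num.min e0 (Num.min 1 eps).
have e_gt0 : 0 < e by rewrite !lt_min e0_gt0 ltr01.
have e_le1 : e <= 1 by rewrite !ge_min lexx orbT.
have e_eps : e <= eps by rewrite !ge_min lexx !orbT.
have ee0 : 0 < e <= e0 by rewrite e_gt0 ge_min lexx.
(* The denominator x + 1 makes delta < D x k imply delta x < k even when x = 0. *)
pose D x k : R := k / (x + 1).
have D_gt0 x k : 0 <= x -> 0 < k -> 0 < D x k by move=> *;
  rewrite divr_gt0// ltr_wpDl.
have DP x k delta : 0 <= x -> 0 <= delta -> 0 < k -> delta < D x k -> delta * x
  < k.
  move=> x0 dl k0; rewrite ltr_pdivlMr ?ltr_wpDl//; lra.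
have p2 : 0 < 2 ^+ d :> R by rewrite exprn_gt0.
have k1 : 0 < normc c / 2 by rewrite divr_gt0.
have k2 : 0 < normc c / 2 ^+ d by rewrite divr_gt0.
have k3 : 0 < normc c / 2 * (e / 2) ^+ d by rewrite mulr_gt0// exprn_gt0//
  divr_gt0.
have k4 : 0 < e / 3 by rewrite divr_gt0.
have x2 : 0 <= A * 2 ^+ d by rewrite mulr_ge0// ltW.
(* The four bounds secure, in this order, fibers of full degree, the escape alternative, a root near
   each zero of R_0, and the contraction. *)
exists (Num.min (Num.min (D (normc P`_0`_d) (normc c / 2)) (D (A * 2 ^+ d)
  (normc c / 2 ^+ d)))
  (Num.min (D C (normc c / 2 * (e / 2) ^+ d)) (D C (e / 3)))); split.
- by have := roots_radius_ge2; rewrite -/rho; lra.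
- by rewrite !lt_min !D_gt0// normc_ge0.
move=> delta delta_ge0; rewrite ger0_norm// !lt_min.
move=> /andP[/andP[d1 d2] /andP[d3 d4]] G.
have delta1 := DP _ _ _ (normc_ge0 _) delta_ge0 k1 d1.
have delta2 := DP _ _ _ x2 delta_ge0 k2 d2.
have delta3 := DP _ _ _ C0 delta_ge0 k3 d3.
have delta4 := DP _ _ _ C0 delta_ge0 k4 d4.
have expanding := He0 _ ee0.
exists (branch e delta); split.
- move=> i z id; split; first exact: branch_le.
  exists rs`_i; first by rewrite -mem_poly_roots// mem_nth ?size_rs.
  by have := branch_near delta e_gt0 i z; lra.
- move=> i z z' id zr z'r.
  exact: (branch_contraction delta_ge0 lipC).
- move=> z zr; rewrite (corr_mult_fin degR0 degP delta_ge0 delta1) (map_comp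
    (@fin_pt R) (fun i => branch e delta i z)).
  exact: perm_map (fiber_roots_branch delta_ge0 lipC e_gt0 expanding delta1
    delta3 zr).
- move=> z; exists (poly_roots G.[z%:P]);
    first exact: (corr_mult_fin degR0 degP).
  have Gz := fiber_neq0 degR0 degP delta_ge0 delta1 z.
  split; first by rewrite size_poly_roots// (fiber_size degR0 degP delta_ge0
    delta1).
  by move=> w; rewrite mem_poly_roots.
- move=> z w; exact: (root_escape delta_ge0 growthA).
Qed.

End Branches.

(** * The sphere and the graph over finite points *)

Section SphereTopology.
Context {R : realType}.
Implicit Types (z w : R[i]) (U : set (sphere R)).

Lemma normrCE z : `|z| = (normc z)%:C. Proof. by []. Qed.

(** Balls of [R[i]^o] have radii in [R[i]], whose partial order compares only numbers with equal
    imaginary parts; this allows real radii throughout. *)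
Lemma complex_gt0P (e : R[i]) : 0 < e -> exists2 a : R, 0 < a & e = a%:C.
Proof.
case: e => a b; rewrite ltcE/= => /andP[/eqP -> a0]; by exists a.
Qed.

Lemma nbhs_complexP z (U : set R[i]) : nbhs (z : R[i]^o) (U : set R[i]^o) <->
  exists2 e : R, 0 < e & forall w, normc (w - z) < e -> U w.
Proof.
split=> [/nbhs_ballP[_ /complex_gt0P[e e0 ->] H]|[e e0 H]].
  exists e => // w wz; apply: H.
  by rewrite -ball_normE /= normrCE ltcR -normcB.
apply/nbhs_ballP; exists e%:C; first by rewrite /= ltcR.
by move=> w; rewrite -ball_normE /= normrCE ltcR normcB; exact: H.
Qed.

Lemma nbhs_finP z U : nbhs (fin_pt z) U <->
  exists2 e : R, 0 < e & forall w, normc (w - z) < e -> U (fin_pt w).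
Proof. exact: nbhs_complexP. Qed.

Lemma open_fin_ball z (e : R) :
  open [set fin_pt w | w in [set w | normc (w - z) < e]].
Proof.
rewrite openE => _ [w /= wz <-]; apply/nbhs_finP.
exists (e - normc (w - z)); first by rewrite subr_gt0.
move=> v vw; exists v => //=.
by have := normc_triangle w v z; lra.
Qed.

Lemma closed_cball (M : R) : closed ([set z | normc z <= M] : set R[i]^o).
Proof.
rewrite -[X in closed X]setCK; apply: open_closedC; rewrite openE => z /= zM.
apply/nbhs_complexP; exists (normc z - M); first by rewrite subr_gt0 ltNge;
  apply/negP.
by move=> w wz /= wM; have := normcD (z - w) w; rewrite subrK normcB; lra.
Qed.

Lemma normc_le_ReIm z : normc z <= `|complex.Re z| + `|complex.Im z|.
Proof.
case: z => a b /=; have := normcD (a +i* 0) (0 +i* b).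
by rewrite /= addr0 add0r expr0n/= addr0 add0r !sqrtr_sqr.
Qed.

Lemma normr_Re_le z : `|complex.Re z| <= normc z.
Proof. by have := normc_ge_Re z; rewrite normrCE lecR. Qed.

Lemma normr_Im_le z : `|complex.Im z| <= normc z.
Proof. by case: z => a b /=; rewrite -sqrtr_sqr ler_wsqrtr// lerDr sqr_ge0. Qed.

Lemma compact_cball (M : R) : compact ([set z | normc z <= M] : set R[i]^o).
Proof.
pose F (p : R * R) : R[i]^o := p.1 +i* p.2.
have cF : continuous F.
  move=> [a b] U /nbhs_complexP[e e0 H].
  have e2 : 0 < e / 2 by rewrite divr_gt0.
  exists (ball a (e / 2), ball b (e / 2)); first by split; apply: nbhsx_ballx.
  move=> [x y] [/= ax bY]; apply: H; apply: le_lt_trans (normc_le_ReIm _) _.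
  by move: ax bY; rewrite -!ball_normE /= distrC [`|b - y|]distrC; lra.
apply: (@subclosed_compact _ _ (F @` (`[-M, M] `*` `[-M, M]))).
- exact: closed_cball.
- apply: continuous_compact; first exact: continuous_subspaceT.
  by apply: compact_setX; exact: segment_compact.
- move=> z zM; exists (complex.Re z, complex.Im z); last by case: z {zM}.
  have := normr_Re_le z; have := normr_Im_le z;
    rewrite !ler_norml => /andP[a1 a2] /andP[b1 b2].
  move: zM => /= zM; split=> /=; rewrite in_itv/=; apply/andP; split; lra.
Qed.

Lemma nbhs_infty (M : R) : nbhs (infty_pt : sphere R)
  (~` [set fin_pt z | z in [set z | normc z <= M]]).
Proof.
exists [set z | normc z <= M].
  by split; [exact: compact_cball|exact: closed_cball].
by move=> _ [[z zM <-]|->] [w wM]//= [] wz; apply: zM; rewrite -wz.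
Qed.

Lemma sphere_hausdorff : hausdorff_space (sphere R).
Proof.
apply: one_point_compactification_hausdorff; last exact: norm_hausdorff.
move=> z _; exists [set w | normc w <= normc z + 1].
  rewrite withinET; apply/nbhs_complexP; exists 1 => // w wz /=.
  by have := normcD (w - z) z; rewrite subrK; lra.
by split; [exact: compact_cball|exact: closed_cball].
Qed.

Lemma compact_sphere : compact [set: sphere R].
Proof. exact: one_point_compactification_compact. Qed.

Lemma open_sphere_measurable U : open U -> measurable U.
Proof. exact: sub_sigma_algebra. Qed.

Lemma closed_sphere_measurable U : closed U -> measurable U.
Proof.
move=> cU; rewrite -[U]setCK; apply: measurableC.
by apply: open_sphere_measurable; exact: closed_openC.
Qed.

Lemma continuous_bounded_sphere (phi : sphere R -> R) : continuous phi ->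
  exists2 M : R, 0 <= M & forall x, `|phi x| <= M.
Proof.
move=> cphi; have : compact (phi @` setT).
  by apply: continuous_compact;
    [exact: continuous_subspaceT|exact: compact_sphere].
move=> /compact_bounded[M [_ H]]; exists (`|M| + 1) => [|x].
  by rewrite addr_ge0.
by apply: H; [have := ler_norm M; lra|exists x].
Qed.

End SphereTopology.

Section FiniteGraph.
Context {R : realType} (G : {poly {poly R[i]}}).

Lemma graph_root z w : G.[z, w] = 0 -> graph G (fin_pt z, fin_pt w).
Proof. by move=> Gzw; apply: subset_closure; exists z, w. Qed.

Hypothesis escape : exists rho, forall z w, G.[z, w] = 0 ->
  normc w <= normc z / 2 \/ normc w < rho.

(** Near a finite z the escape alternative keeps the roots bounded, so infinity is not a limit
    point; at a finite w off the curve, G stays nonzero nearby by its local Lipschitz bound. *)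
Lemma graph_fin z w : graph G (fin_pt z, w) ->
  exists2 w', w = fin_pt w' & G.[z, w'] = 0.
Proof.
have [rho rhoP] := escape; case: w => [w|] zw; last first.
  (* For |a - z| < 1 a root b has modulus below (|z| + 1) / 2 or below rho, hence below |z| + |rho|
     + 1. *)
  have [] := zw ([set fin_pt w | w in [set w | normc (w - z) < 1]] `*`
     (~` [set fin_pt w | w in [set w | normc w <= normc z + `|rho| + 1]])).
    eexists (_, _); last exact: subset_refl; split=> /=.
      apply: open_nbhs_nbhs; split; first exact: open_fin_ball.
      by exists z => //=; rewrite subrr normc0.
    exact: nbhs_infty.
  move=> [_ _] [[a [b [[-> ->] Gab]]] [[a' /= + [aa']] bz]].
  rewrite aa' => az; case: bz.
  exists b => //=; have := rhoP _ _ Gab; have := normcD (a - z) z.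
  rewrite subrK; have := ler_norm rho; have := normc_ge0 z; have := normc_ge0 a.
  by have := normr_ge0 rho; lra.
exists w => //; apply/eqP; apply: contraT => Gzw.
have [C C0 H] := poly2_lipschitz G (normc z + normc w + 1).
(* A root (a, b) within e of (z, w) in each coordinate would give |G(z, w)| <= 2 C e < |G(z, w)|. *)
pose e := Num.min 1 (normc G.[z, w] / (2 * C + 1)).
have C1 : 0 < 2 * C + 1 by lra.
have e0 : 0 < e by rewrite lt_min ltr01 divr_gt0// normc_gt0.
have [] := zw ([set fin_pt a | a in [set a | normc (a - z) < e]] `*`
   [set fin_pt a | a in [set a | normc (a - w) < e]]).
  eexists (_, _); last exact: subset_refl; split=> /=.
    apply: open_nbhs_nbhs; split; first exact: open_fin_ball.
    by exists z => //=; rewrite subrr normc0.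
  apply: open_nbhs_nbhs; split; first exact: open_fin_ball.
  by exists w => //=; rewrite subrr normc0.
move=> [_ _] [[a [b [[-> ->] Gab]]] [[a' /= + [aa']] [b' /= + [bb']]]].
rewrite aa' bb' !lt_min !ltr_pdivlMr// => /andP[a1 ae] /andP[b1 be].
have a2 : normc a <= normc z + normc w + 1.
  by have := normcD (a - z) z; rewrite subrK; have := normc_ge0 w; lra.
have b2 : normc b <= normc z + normc w + 1.
  by have := normcD (b - w) w; rewrite subrK; have := normc_ge0 z; lra.
have z2 : normc z <= normc z + normc w + 1 by have := normc_ge0 w; lra.
have w2 : normc w <= normc z + normc w + 1 by have := normc_ge0 z; lra.
have [_] := H _ _ _ _ z2 w2 a2 b2.
rewrite Gab subr0 [normc (z - a)]normcB [normc (w - b)]normcB => h.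
have := mulr_ge0 C0 (normc_ge0 (a - z));
  have := mulr_ge0 C0 (normc_ge0 (b - w)).
by have := normc_ge0 (a - z); have := normc_ge0 (b - w); lra.
Qed.

End FiniteGraph.

(** * Base-d digits and the coding map *)

Section Digits.
Context {R : realType} (d : nat) (d_gt0 : (0 < d)%N).

Local Notation P := (uniform_prob (@ltr01 R)).

Lemma uniform_prob01E (A : set (measurableTypeR R)) : measurable A ->
  P A = lebesgue_measure (A `&` `[0%R, 1%R]).
Proof.
move=> mA; have := @integral_uniform R 0 1 ltr01 (fun x => (\1_A x)%:E).
rewrite integral_indic//= setIT subr0 invr1 mul1e => -> //.
- by rewrite integral_indic.
- by apply/measurable_EFinP/measurable_indic.
Qed.

(* The first m digits of t, as a number; reduction modulo d ^ m bounds it for t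
   outside [0, 1[ too. *)
Definition word (m : nat) (t : R) : nat :=
  (Num.truncn ((d ^ m)%:R * t) %% d ^ m)%N.

Lemma expd_gt0 m : (0 < d ^ m)%N. Proof. by rewrite expn_gt0 d_gt0. Qed.

Lemma word_lt m t : (word m t < d ^ m)%N.
Proof. by rewrite ltn_mod expd_gt0. Qed.

Lemma truncn_mulr_div (x : R) : (Num.truncn (d%:R * x) %/ d)%N = Num.truncn x.
Proof.
have [x0|x0] := leP 0 x; last first.
  have t0 (y : R) : y <= 0 -> Num.truncn y = 0%N.
    by move=> y0; apply/truncn0Pn; rewrite -ltNge (le_lt_trans y0).
  by rewrite !t0 ?div0n ?mulr_ge0_le0// ltW.
have /andP[h1 h2] := truncn_itv x0.
set n := Num.truncn x in h1 h2 *.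
have dx0 : 0 <= d%:R * x by rewrite mulr_ge0.
have /andP[h3 h4] := truncn_itv dx0.
set k := Num.truncn _ in h3 h4 *.
have d0 : 0 < d%:R :> R by rewrite ltr0n.
have : (n * d <= k)%N.
  rewrite -ltnS -(ltr_nat R) natrM (le_lt_trans _ h4)// mulrC ler_pM2l//.
have : (k < n.+1 * d)%N.
  by rewrite -(ltr_nat R) natrM (le_lt_trans h3)// mulrC ltr_pM2r//.
by move=> kn nk; apply/eqP; rewrite eqn_leq -ltnS ltn_divLR// kn leq_divRL.
Qed.

Lemma word_div m t : (word m.+1 t %/ d)%N = word m t.
Proof.
by rewrite /word expnSr -modn_divl natrM mulrAC mulrC truncn_mulr_div.
Qed.

Lemma truncn_eqP (D t : R) (n : nat) : 0 < D ->
  Num.truncn (D * t) = n <->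
  (n = 0%N /\ t < D^-1) \/ (n%:R / D <= t < n.+1%:R / D).
Proof.
move=> D0; rewrite ler_pdivrMr// ltr_pdivlMr// -[D^-1]div1r ltr_pdivlMr//.
rewrite [t * D]mulrC; split=> [<-|[[-> t1]|/truncn_def//]]; last first.
  by apply/truncn0Pn; rewrite -ltNge.
have [t0|t0] := leP 0 (D * t); first by right; exact: truncn_itv.
left; split; last exact: lt_trans t0 _.
by apply/truncn0Pn; rewrite -ltNge (lt_trans t0).
Qed.

Lemma measurable_truncn_eq (D : R) (n : nat) : 0 < D ->
  measurable ([set t | Num.truncn (D * t) = n] : set (measurableTypeR R)).
Proof.
move=> D0.
have -> : [set t | Num.truncn (D * t) = n] =
    (if n == 0%N then [set` `]-oo, D^-1[] else set0) `|`
    [set` `[n%:R / D, n.+1%:R / D[].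
  apply/seteqP; split=> t /=.
    move=> /(truncn_eqP t n D0)[[-> tD]|tD]; first by left; rewrite /= in_itv.
    by right; rewrite in_itv.
  move=> H; apply/(truncn_eqP t n D0); case: H => [|]; last first.
    by rewrite in_itv/=; right.
  by case: eqP => // ->; rewrite /= in_itv/=; left.
apply: measurableU; last exact: measurable_itv.
by case: ifP => _; [exact: measurable_itv|exact: measurable0].
Qed.

Lemma measurable_word (m : nat) (Y : set nat) :
  measurable ([set t | Y (word m t)] : set (measurableTypeR R)).
Proof.
have -> : [set t | Y (word m t)] = \bigcup_(n in [set n | Y (n %% d ^ m)%N])
    [set t | Num.truncn ((d ^ m)%:R * t) = n].
  apply/seteqP; split=> t /=; last by move=> [n /= Yn tn]; rewrite /word tn.
  by move=> Yt; exists (Num.truncn ((d ^ m)%:R * t)).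
apply: bigcup_measurable => n _; apply: measurable_truncn_eq.
by rewrite ltr0n expd_gt0.
Qed.

Lemma prob_word m k : (k < d ^ m)%N ->
  P [set t | word m t = k] = ((d ^ m)%:R^-1)%:E.
Proof.
move=> km; have D0 : 0 < (d ^ m)%:R :> R by rewrite ltr0n expd_gt0.
set A := [set t | word m t = k].
have mA : measurable (A : set (measurableTypeR R)) by exact: (measurable_word m
  [set j | j = k]).
rewrite uniform_prob01E//.
(* The endpoint 1 is split off: reduction modulo d^m sends it to the word 0, outside the dyadic-type
   interval of that word, and it has measure 0. *)
have -> : A `&` `[0, 1] = [set` `[k%:R / (d ^ m)%:R, k.+1%:R / (d ^ m)%:R[] `|`
  (A `&` [set 1]).
  apply/seteqP; split=> t /=; rewrite !in_itv/=.
    move=> [At /andP[t0]]; rewrite le_eqVlt => /predU1P[t1|t1]; first by right.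
    left; have /andP[h1 h2] := truncn_itv (mulr_ge0 (ltW D0) t0).
    have tlt : (Num.truncn ((d ^ m)%:R * t) < d ^ m)%N.
      by rewrite -(ltr_nat R) (le_lt_trans h1)// gtr_pMr.
    move: At h1 h2; rewrite /A /= /word modn_small// => ->.
    by rewrite ler_pdivrMr// ltr_pdivlMr// mulrC => -> ->.
  move=> [/andP[t0 t1]|[At tE]]; last by split=> //; rewrite tE ler01 lexx.
  have tk : Num.truncn ((d ^ m)%:R * t) = k.
    by apply/truncn_eqP => //; right; rewrite t0.
  split; first by rewrite /A /= /word tk modn_small.
  apply/andP; split; first by rewrite (le_trans _ t0)// divr_ge0.
  by rewrite ltW// (lt_le_trans t1)// ler_pdivrMr// mul1r ler_nat.
rewrite measureU//=; last 2 first.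
- by apply: measurableI.
- apply/seteqP; split=> // t /= [+ [_ t1]]; rewrite in_itv/= t1 => /andP[_].
  by rewrite ltr_pdivlMr// mul1r ltr_nat ltnS leqNgt km.
have -> : lebesgue_measure (A `&` [set 1 : R]) = 0%E.
  have m1 : measurable ([set 1] : set (measurableTypeR R)) by exact:
    measurable_set1.
  apply: (subset_measure0 (measurableI _ _ mA m1) m1); first exact: subIsetr.
  exact: lebesgue_measure_set1.
rewrite adde0 lebesgue_measure_itv/= lte_fin ltr_pM2r ?invr_gt0// ltr_nat ltnSn.
by rewrite -EFinB -mulrBl -natrB// subSnn mul1r.
Qed.

(** The integrand is a step function of the word, so [c] may be arbitrary. Averages over all words
    of length m become integrals over one fixed space, as dominated convergence requires. *)
Lemma integral_word m (c : nat -> R) :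
  (\int[P]_t (c (word m t))%:E =
    ((d ^ m)%:R^-1 * \sum_(0 <= k < d ^ m) c k)%:E)%E.
Proof.
pose F k := [set t : measurableTypeR R | word m t = k].
have mF k : measurable (F k) by exact: (measurable_word m [set j | j = k]).
have TE : [set: measurableTypeR R] = \big[setU/set0]_(k <- index_iota 0 (d ^
  m)) F k.
  rewrite -bigcup_seq; apply/seteqP; split=> // t _; exists (word m t) => //=.
  by rewrite mem_index_iota word_lt.
rewrite {1}TE integral_bigsetU_EFin//.
- rewrite mulr_sumr -sumEFin big_seq [RHS]big_seq; apply: eq_bigr => k.
  rewrite mem_index_iota => /andP[_ km].
  rewrite (eq_integral (cst (c k)%:E)); last first.
    by move=> t; rewrite inE => ->.
  transitivity ((c k)%:E * P (F k))%E; first exact: integral_cst.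
  by rewrite [P (F k)]prob_word// -EFinM mulrC.
- exact: iota_uniq.
- by apply/trivIsetP => i j _ _ ij; apply/seteqP; split=> // t [wi wj];
    case/eqP: ij; rewrite -wi -wj.
- rewrite -TE => _ Y mY; rewrite setTI;
    exact: (measurable_word m [set k | Y (c k)%:E]).
Qed.

(** These are the points where some word can jump; there are countably many of them. *)
Definition dadic : set R := [set t | exists m n : nat, t = n%:R / (d ^ m)%:R].

Lemma word_locally_constant m t : ~ dadic t ->
  \forall s \near t, word m s = word m t.
Proof.
move=> tD; have D0 : 0 < (d ^ m)%:R :> R by rewrite ltr0n expd_gt0.
suff [a [b [/near_in_itvoo tab H]]] : exists a b, (t \in `]a, b[) /\
    forall s, (s \in `]a, b[) -> Num.truncn ((d ^ m)%:R * s) = Num.truncn ((d ^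
      m)%:R * t).
  by near=> s; rewrite /word (H s)//; near: s; exact: tab.
have /(truncn_eqP _ _ D0) [[n0 t0]|/andP[t0 t1]] := erefl (Num.truncn ((d ^
  m)%:R * t)).
  exists (t - 1), (d ^ m)%:R^-1; rewrite in_itv/= t0 andbT ltrBlDr ltrDl.
  split=> // s; rewrite in_itv/= => /andP[_ s0]; rewrite n0.
  by apply/truncn_eqP => //; left.
exists ((Num.truncn ((d ^ m)%:R * t))%:R / (d ^ m)%:R), ((Num.truncn ((d ^
  m)%:R * t)).+1%:R / (d ^ m)%:R).
split.
  rewrite in_itv/= t1 andbT lt_neqAle t0 andbT; apply/eqP => h.
  by apply: tD; exists m, (Num.truncn ((d ^ m)%:R * t)).
move=> s; rewrite in_itv/= => /andP[s0 s1].
by apply/truncn_eqP => //; right; rewrite ltW.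
Unshelve. all: by end_near. Qed.

Lemma dadicE : dadic = \bigcup_m \bigcup_n [set n%:R / (d ^ m)%:R].
Proof.
apply/seteqP; split=> t; first by move=> [m [n tE]]; exists m => //; exists n.
by move=> [m _ [n _ tE]]; exists m, n.
Qed.

Lemma measurable_dadic : measurable (dadic : set (measurableTypeR R)).
Proof.
by rewrite dadicE; do 2!apply: bigcup_measurable => ? _; exact: measurable_set1.
Qed.

Lemma countable_dadic : countable dadic.
Proof.
by rewrite dadicE; do 2!apply: bigcup_countable => // ? _; exact: countable1.
Qed.

(** The compact set avoids the d-adic rationals so that the coding map is continuous at each of its
    points; discarding this null set costs no mass. *)
Lemma uniform_prob_inner_regular (A : set (measurableTypeR R)) (e : R) :
  measurable A -> 0 < e ->
  exists K : set R, [/\ compact K, K `<=` A, K `<=` ~` dadic &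
    (P (A `\` K) < e%:E)%E].
Proof.
move=> mA e0; pose B : set (measurableTypeR R) := (A `&` `[0, 1]) `\` dadic.
have mB : measurable B.
  apply: measurableD; last exact: measurable_dadic.
  by apply: measurableI => //; exact: measurable_itv.
have Boo : (lebesgue_measure B < +oo)%E.
  apply: (@le_lt_trans _ _ (lebesgue_measure `[0%R, 1%R])).
    by apply: le_measure; rewrite ?inE// => t [[]].
  by rewrite lebesgue_measure_itv/= lte_fin ltr01 -EFinB ltry.
have [K [cK KB Ke]] := lebesgue_regularity_inner mB Boo e0.
have mK : measurable (K : set (measurableTypeR R)) by exact: compact_measurable.
exists K; split=> //; [by move=> t /KB[[]]|by move=> t /KB[]|].
rewrite uniform_prob01E; last exact: measurableD.
apply: le_lt_trans Ke.
apply: (@le_trans _ _ (lebesgue_measure (B `\` K) + lebesgue_measure dadic)%E).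
  apply: le_trans (measureU2 _ _ _); last 2 first.
  - exact: measurableD.
  - exact: measurable_dadic.
  apply: le_measure; rewrite ?inE.
  - apply: measurableI; first exact: measurableD.
    exact: measurable_itv.
  - apply: measurableU; last exact: measurable_dadic.
    exact: measurableD.
  move=> t [[At nKt] t01]; have [tD|tD] := pselect (dadic t); first by right.
  by left.
by rewrite (countable_lebesgue_measure0 countable_dadic) adde0.
Qed.

End Digits.

(** The intervals of radius K / 2^m around u_m meet pairwise, so the supremum of their left ends
    lies in all of them. The explicit rate is needed later. *)
Lemma cauchy_rate_real {R : realType} (u : nat -> R) (K : R) :
  (forall m n, `|u (m + n)%N - u m| <= K / 2 ^+ m) ->
  exists l, forall m, `|l - u m| <= K / 2 ^+ m.
Proof.
move=> H; pose S := range (fun m => u m - K / 2 ^+ m).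
have upper n : ubound S (u n + K / 2 ^+ n).
  move=> _ [m _ <-]; have [mn|nm] := leqP m n.
    have := H m (n - m)%N; rewrite subnKC// ler_norml => /andP[h _].
    by have := H n 0%N; have := normr_ge0 (u (n + 0)%N - u n); lra.
  have := H n (m - n)%N; rewrite subnKC 1?ltnW// ler_norml => /andP[_ h].
  by have := H m 0%N; have := normr_ge0 (u (m + 0)%N - u m); lra.
exists (sup S) => m; rewrite ler_norml; apply/andP; split.
  rewrite lerBrDl addrC.
  have : u m - K / 2 ^+ m <= sup S.
    by apply: ub_le_sup; [exists (u 0%N + K / 2 ^+ 0); exact: upper|exists m].
  lra.
have : sup S <= u m + K / 2 ^+ m; last lra.
by apply: ge_sup; [exists (u 0%N - K / 2 ^+ 0); exists 0%N|exact: upper].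
Qed.

(** The factor 2 comes from treating real and imaginary parts separately. *)
Lemma cauchy_rate_complex {R : realType} (u : nat -> R[i]) (K : R) :
  (forall m n, normc (u (m + n)%N - u m) <= K / 2 ^+ m) ->
  exists l, forall m, normc (l - u m) <= 2 * K / 2 ^+ m.
Proof.
move=> H.
have [m n|a aP] := @cauchy_rate_real R (fun m => complex.Re (u m)) K.
  by rewrite -raddfB; exact: le_trans (normr_Re_le _) (H m n).
have [m n|b bP] := @cauchy_rate_real R (fun m => complex.Im (u m)) K.
  by rewrite -raddfB; exact: le_trans (normr_Im_le _) (H m n).
exists (a +i* b) => m; apply: le_trans (normc_le_ReIm _) _; rewrite !raddfB/=.
by have := aP m; have := bP m; rewrite -mulrA mulr_natl mulr2n; lra.
Qed.

(** * The coding map as a limit of branch compositions *)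

Section Coding.
Context {R : realType} (d : nat) (d_gt0 : (0 < d)%N).
Variables (rho : R) (f : nat -> R[i] -> R[i]).
Hypothesis rho_gt1 : 1 < rho.
Hypothesis f_le : forall i z, (i < d)%N -> normc (f i z) <= rho - 1.
Hypothesis f_contr : forall i z z', (i < d)%N -> normc z < rho ->
  normc z' < rho -> normc (f i z - f i z') <= normc (z - z') / 2.

(* The least significant base-d digit of k is applied first. *)
Fixpoint branch_comp (m k : nat) (z : R[i]) : R[i] :=
  if m is m'.+1 then branch_comp m' (k %/ d) (f (k %% d) z) else z.

Let f_lt i z : (i < d)%N -> normc (f i z) < rho.
Proof. by move=> /(f_le z)/le_lt_trans; apply; rewrite gtrBl. Qed.

Let modd k : (k %% d < d)%N. Proof. by rewrite ltn_mod. Qed.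

Lemma branch_comp_lt m k z : normc z < rho -> normc (branch_comp m k z) < rho.
Proof. by elim: m k z => //= m IH k z zr; apply/IH/f_lt. Qed.

Lemma branch_comp_contraction m k z z' : normc z < rho -> normc z' < rho ->
  normc (branch_comp m k z - branch_comp m k z') <= normc (z - z') / 2 ^+ m.
Proof.
elim: m k z z' => [|m IH] k z z' zr z'r /=; first by rewrite expr0 divr1.
apply: le_trans (IH _ _ _ _ _) _; [exact: f_lt|exact: f_lt|].
rewrite exprSr invfM mulrA [_ / _ / _]mulrAC ler_pM2r ?invr_gt0 ?exprn_gt0//.
exact: f_contr.
Qed.

(** The most significant digit acts last, so a nonempty composition takes its value in the image of
    a branch; this confines limits of compositions. *)
Lemma branch_comp_head m k z : normc z < rho -> (k < d ^ m.+1)%N ->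
  exists i z', [/\ (i < d)%N, normc z' < rho & branch_comp m.+1 k z = f i z'].
Proof.
elim: m k z => [|m IH] k z zr km.
  by exists (k %% d)%N, z.
have [||i [z' [id z'r E]]] := IH (k %/ d)%N (f (k %% d) z); first exact: f_lt.
  by rewrite ltn_divLR// -expnSr.
by exists i, z'; split.
Qed.

(** The n additional digits are less significant and act first: they merely move the starting point
    to another point of the disk. *)
Lemma branch_comp_word m n (t : R) b : normc b < rho ->
  exists2 b', normc b' < rho &
    branch_comp (m + n) (word d (m + n) t) b = branch_comp m (word d m t) b'.
Proof.
elim: n b => [|n IH] b br; first by rewrite addn0; exists b.
have [|b' b'r E] := IH (f (word d (m + n.+1) t %% d) b); first exact: f_lt.
by exists b' => //; rewrite -E addnS /= word_div.
Qed.

Let normc0r : normc (0 : R[i]) < rho.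
Proof. by rewrite normc0 (lt_trans ltr01). Qed.

Lemma branch_comp_word_cauchy m n (t : R) b : normc b < rho ->
  normc (branch_comp (m + n) (word d (m + n) t) 0 -
         branch_comp m (word d m t) b) <= 2 * rho / 2 ^+ m.
Proof.
move=> br; have [b' b'r ->] := branch_comp_word m n t normc0r.
apply: le_trans (branch_comp_contraction _ _ _ _) _ => //.
rewrite ler_pM2r ?invr_gt0 ?exprn_gt0//.
by apply: le_trans (normcD _ _) _; rewrite normcN; lra.
Qed.

(** In the constant 6 rho, 4 rho comes from the limit along the starting point 0 and 2 rho from
    replacing 0 by b. *)
Lemma coding_exists : exists g : R -> R[i], forall t m b, normc b < rho ->
  normc (g t - branch_comp m (word d m t) b) <= 6 * rho / 2 ^+ m.
Proof.
suff : forall t : R, exists l, forall m b, normc b < rho ->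
  normc (l - branch_comp m (word d m t) b) <= 6 * rho / 2 ^+ m.
  move=> H; exists (fun t => sval (cid (H t))) => t.
  exact: svalP (cid (H t)).
move=> t.
have [m n|l lP] := @cauchy_rate_complex R (fun m => branch_comp m (word d m t)
  0) (2 * rho).
  exact: branch_comp_word_cauchy.
exists l => m b br; apply: le_trans (normc_triangle (branch_comp m (word d m t)
  0) _ _) _.
have := branch_comp_word_cauchy m 0 t br; rewrite addn0 => h.
have -> : 6 * rho / 2 ^+ m = 2 * (2 * rho) / 2 ^+ m + 2 * rho / 2 ^+ m.
  by rewrite -mulrDl; congr (_ / _); ring.
exact: lerD.
Qed.

Definition coding : R -> R[i] := sval (cid coding_exists).

Lemma codingP t m b : normc b < rho ->
  normc (coding t - branch_comp m (word d m t) b) <= 6 * rho / 2 ^+ m.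
Proof. exact: (svalP (cid coding_exists)). Qed.

Lemma coding_rate_small (e : R) : 0 < e ->
  exists m, forall n, (m <= n)%N -> 6 * rho / 2 ^+ n < e.
Proof.
move=> e0; exists (Num.truncn (6 * rho / e)).+1 => n mn.
rewrite ltr_pdivrMr ?exprn_gt0// [e * _]mulrC -ltr_pdivrMr// (lt_le_trans
  (truncnS_gt _))//.
have -> : 2 ^+ n = (2 ^ n)%:R :> R by rewrite natrX.
by rewrite ler_nat (leq_trans mn)// ltnW// ltn_expl.
Qed.

Lemma coding_near_branch t (e : R) : 0 < e ->
  exists i z, [/\ (i < d)%N, normc z < rho & normc (coding t - f i z) < e].
Proof.
move=> e0; have [m mP] := coding_rate_small e0.
have [i [z [id zr E]]] := @branch_comp_head m (word d m.+1 t) 0 normc0r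
  (word_lt d_gt0 _ _).
exists i, z; split=> //; rewrite -E; apply: le_lt_trans (codingP _ _ normc0r) _.
exact: mP.
Qed.

Lemma coding_lt t : normc (coding t) < rho.
Proof.
have [i [z [id zr E]]] := coding_near_branch t ltr01.
have := normcD (coding t - f i z) (f i z); rewrite subrK.
by have := f_le z id; lra.
Qed.

End Coding.

(** * The self-similar measure *)

Section IntegralOffNull.
Context d (T : measurableType d) (R : realType).
Variable mu : {measure set T -> \bar R}.

(** The integral of a nonnegative function is a supremum over simple functions below it, measurable
    or not. Cutting such a simple function off on N keeps its integral and puts it below g. *)
Lemma ge0_integral_off_null (N : set T) (f g : T -> \bar R) :
  measurable N -> mu N = 0%E ->
  (forall x, 0 <= f x)%E -> (forall x, 0 <= g x)%E ->
  (forall x, ~ N x -> f x = g x) -> (\int[mu]_x f x <= \int[mu]_x g x)%E.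
Proof.
move=> mN N0 f0 g0 fg; rewrite ge0_integralTE// ge0_integralTE//.
apply: ge_ereal_sup => _ [h hf <-].
have mNc : measurable (~` N) by exact: measurableC.
apply: ereal_sup_ubound; exists (proj_nnsfun h mNc) => /=.
  move=> x; rewrite mindicE; have [xN|xN] := boolP (x \in ~` N).
    by rewrite mulr1 -fg//; move: xN; rewrite inE.
  by rewrite mulr0.
rewrite -!integralT_nnsfun; apply: ge0_ae_eq_integral => //.
- exact/measurable_EFinP.
- exact/measurable_EFinP.
- by move=> x _; rewrite lee_fin.
- by move=> x _; rewrite lee_fin.
exists N; split=> // x /=; apply: contra_notP => xN _.
by rewrite mindicE mem_set// mulr1.
Qed.

(* No measurability of f and g: z |-> sum of phi over F(z) is only controlled on
   the disk |z| < rho, outside which mu vanishes. *)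
Lemma integral_off_null (N : set T) (f g : T -> \bar R) :
  measurable N -> mu N = 0%E ->
  (forall x, ~ N x -> f x = g x) -> (\int[mu]_x f x = \int[mu]_x g x)%E.
Proof.
move=> mN N0 fg; rewrite integralE [RHS]integralE; congr (_ - _)%E.
- by apply/eqP; rewrite eq_le; apply/andP; split;
    apply: ge0_integral_off_null mN N0 _ _ _ => // x /fg;
      rewrite !funeposE => ->.
- by apply/eqP; rewrite eq_le; apply/andP; split;
    apply: ge0_integral_off_null mN N0 _ _ _ => // x /fg;
      rewrite !funenegE => ->.
Qed.

End IntegralOffNull.

Lemma integral_bounded_pushforward {d d'} {T : measurableType d}
    {T' : measurableType d'} {R : realType} (P : probability T R)
    (X : {RV P >-> T'}) (phi : T' -> R) (M : R) :
  measurable_fun setT phi -> (forall x, `|phi x| <= M) ->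
  (\int[distribution P X]_x (phi x)%:E = \int[P]_t (phi (X t))%:E)%E.
Proof.
move=> mphi phiM; rewrite integral_distribution//; first exact/measurable_EFinP.
apply: (@measurable_bounded_integrable _ _ _ _ (phi \o X)) => //.
- by rewrite (le_lt_trans (probability_le1 _ _))// ltry.
- exact: measurableT_comp.
- exists M; split; first by rewrite num_real.
  by move=> y My x _ /=; exact: le_trans (phiM _) (ltW My).
Qed.

Section CodingMeasure.
Context {R : realType} (d : nat) (d_gt0 : (0 < d)%N).
Variables (rho : R) (f : nat -> R[i] -> R[i]).
Hypothesis rho_gt1 : 1 < rho.
Hypothesis f_le : forall i z, (i < d)%N -> normc (f i z) <= rho - 1.
Hypothesis f_contr : forall i z z', (i < d)%N -> normc z < rho ->
  normc z' < rho -> normc (f i z - f i z') <= normc (z - z') / 2.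

Local Notation g := (coding d_gt0 rho_gt1 f_le f_contr).
Local Notation gP := (codingP d_gt0 rho_gt1 f_le f_contr).
Local Notation P := (uniform_prob (@ltr01 R)).
Local Notation compw := (branch_comp d f).

Definition coding_pt (t : measurableTypeR R) : sphere R := fin_pt (g t).

Let normc0r : normc (0 : R[i]) < rho.
Proof. by rewrite normc0 (lt_trans ltr01). Qed.

(** Membership in the preimage of an open U is decided by a finite word: for some m, the ball of
    twice the error radius around the m-th approximation lies in U. Doubling turns the weak error
    bound into a strict one, and conversely three error radii fit into any ball around a point of U
    for large m. *)
Lemma measurable_coding_pt : measurable_fun setT coding_pt.
Proof.
apply: (measurability (open : set (set (sphere R)))) => //.
move=> _ [U oU <-]; rewrite setTI.
have K0 : 0 < 6 * rho by rewrite mulr_gt0// (lt_trans ltr01).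
have -> : coding_pt @^-1` U = \bigcup_m [set t | forall w,
    normc (w - compw m (word d m t) 0) < 2 * (6 * rho / 2 ^+ m) -> U (fin_pt
      w)].
  apply/seteqP; split=> t /=; last first.
    move=> [m _ /= H]; apply: H; apply: le_lt_trans (gP _ _ normc0r) _.
    by rewrite ltr_pMl ?ltr1n// divr_gt0// exprn_gt0.
  move=> Ut; have /nbhs_finP[e e0 He] : nbhs (fin_pt (g t)) U.
    by apply: open_nbhs_nbhs; split.
  have [m mP] := coding_rate_small rho (divr_gt0 e0 (ltr0n R 3)).
  exists m => // w; have := gP t m normc0r; have := mP _ (leqnn m) => h1 h2 h3.
  apply: He; apply: le_lt_trans (normc_triangle (compw m (word d m t) 0) _ _) _.
  by rewrite [normc (_ - g t)]normcB; lra.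
apply: bigcupT_measurable => m.
exact: (measurable_word d_gt0 m [set k | forall w,
    normc (w - compw m k 0) < 2 * (6 * rho / 2 ^+ m) -> U (fin_pt w)]).
Qed.

HB.instance Definition _ :=
  isMeasurableFun.Build _ _ _ _ coding_pt measurable_coding_pt.

Definition coding_measure : probability (sphere R) R :=
  distribution P coding_pt.

Lemma coding_measure_integral (phi : sphere R -> R) (M : R) :
  measurable_fun setT phi -> (forall x, `|phi x| <= M) ->
  (\int[coding_measure]_x (phi x)%:E = \int[P]_t (phi (coding_pt t))%:E)%E.
Proof. exact: integral_bounded_pushforward. Qed.

(** The averages are integrals of step functions over [0, 1] that converge pointwise. Continuity is
    required on the open disk alone, so that [branch_avg] of a test function is admissible. *)
Lemma coding_weak_limit (phi : R[i] -> R) (M : R) b : normc b < rho ->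
  (forall z, normc z < rho ->
    {for (z : R[i]^o), continuous (phi : R[i]^o -> R)}) ->
  (forall z, `|phi z| <= M) ->
  ((d ^ m)%:R^-1 * \sum_(0 <= k < d ^ m) phi (compw m k b))%:E
    @[m --> \oo] --> (\int[P]_t (phi (g t))%:E)%E.
Proof.
move=> br cphi phiM.
have -> : (fun m => ((d ^ m)%:R^-1 * \sum_(0 <= k < d ^ m) phi (compw m k
  b))%:E) =
   (fun m => \int[P]_t (phi (compw m (word d m t) b))%:E)%E.
  by apply/funext => m;
    rewrite (integral_word d_gt0 m (fun k => phi (compw m k b))).
apply: (@dominated_cvg _ _ _ P setT measurableT
   (fun m t => (phi (compw m (word d m t) b))%:E) _ (cst M%:E)) => //.
- move=> m _ Y mY; rewrite setTI.
  exact: (measurable_word d_gt0 m [set k | Y (phi (compw m k b))%:E]).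
- move=> t _; apply: cvg_EFin; first exact: nearW.
  apply: (@continuous_cvg _ _ _ _ _ _ (phi : R[i]^o -> R)).
    exact: cphi (coding_lt _ _ _ _ _).
  move=> U /nbhs_complexP[e e0 He].
  have [m mP] := coding_rate_small rho e0.
  exists m => // n /= mn; apply: He; rewrite normcB.
  by apply: le_lt_trans (gP _ _ br) (mP _ mn).
- apply: (@measurable_bounded_integrable _ _ _ _ (cst M)) => //.
    by rewrite (le_lt_trans (probability_le1 _ _))// ltry.
  exists `|M|; split; first by rewrite num_real.
  by move=> y My x _; exact: ltW.
- by move=> m t _; rewrite /= lee_fin.
Qed.

End CodingMeasure.

Lemma sum_mv_iterS {R : realType} (T : Type) (F : T -> seq T) (phi : T -> R)
    m a :
  \sum_(w <- mv_iter F m.+1 a) phi w =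
  \sum_(w <- mv_iter F m a) \sum_(v <- F w) phi v.
Proof. by rewrite /= big_flatten big_map. Qed.

Lemma sum_mv_iterD {R : realType} (T : Type) (F : T -> seq T) (phi : T -> R)
    n m a :
  \sum_(w <- mv_iter F (n + m) a) phi w =
  \sum_(b <- mv_iter F n a) \sum_(w <- mv_iter F m b) phi w.
Proof.
elim: m phi => [|m IH] phi.
  by rewrite addn0; apply: eq_bigr => b _; rewrite big_seq1.
rewrite addnS sum_mv_iterS IH; apply: eq_bigr => b _.
by rewrite sum_mv_iterS.
Qed.

Lemma big_nat_divmod {R : realType} (N d : nat) (G : nat -> nat -> R) :
  (0 < d)%N ->
  \sum_(0 <= k < N * d) G (k %/ d)%N (k %% d)%N =
  \sum_(0 <= q < N) \sum_(0 <= i < d) G q i.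
Proof.
move=> d0; elim: N => [|N IH]; first by rewrite mul0n !big_nil.
rewrite big_nat_recr//= -IH (@big_cat_nat _ _ _ (N * d))//=;
  last by rewrite leq_mul2r leqnSn orbT.
congr (_ + _); rewrite -{1}[(N * d)%N]add0n big_addn mulSn addnK.
rewrite big_nat [RHS]big_nat; apply: eq_bigr => i /andP[_ id].
by rewrite addnC divnMDl// modnMDl divn_small// addn0 modn_small.
Qed.

Lemma cvg_sum_same_limit {R : realType} (T : eqType) (s : seq T)
    (u : T -> nat -> R) (l : R) :
  (forall x, x \in s -> u x m @[m --> \oo] --> l) ->
  (\sum_(x <- s) u x m) @[m --> \oo] --> (size s)%:R * l.
Proof.
elim: s => [|x s IH] H.
  rewrite mul0r; under eq_fun do rewrite big_nil; exact: cvg_cst.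
under eq_fun do rewrite big_cons.
rewrite /= -natr1 mulrDl mul1r addrC; apply: cvgD; first by apply: H;
  exact: mem_head.
by apply: IH => y ys; apply: H; rewrite in_cons ys orbT.
Qed.

Lemma integral_mscale_bounded {d} {T : measurableType d} {R : realType}
    (m : {measure set T -> \bar R}) (k : {nonneg R}) (phi : T -> R) (M : R) :
  (m setT < +oo)%E -> measurable_fun setT phi -> (forall x, `|phi x| <= M) ->
  (\int[mscale k m]_x (phi x)%:E = k%:num%:E * \int[m]_x (phi x)%:E)%E.
Proof.
move=> moo mphi phiM.
have mE : measurable_fun setT (EFin \o phi) by exact/measurable_EFinP.
have im : m.-integrable setT (EFin \o phi).
  apply: measurable_bounded_integrable => //.
  exists M; split; first by rewrite num_real.
  by move=> y My x _ /=; exact: le_trans (phiM _) (ltW My).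
have mP := measurable_funepos mE; have mN := measurable_funeneg mE.
have fN := integrable_neg_fin_num measurableT im.
pose p := (EFin \o phi)^\+%E; pose n := (EFin \o phi)^\-%E.
have -> : (\int[mscale k m]_x (phi x)%:E =
    \int[mscale k m]_x p x - \int[mscale k m]_x n x)%E by exact: integralE.
have -> : (\int[m]_x (phi x)%:E = \int[m]_x p x - \int[m]_x n x)%E.
  exact: integralE.
rewrite (ge0_integral_mscale m measurableT k mP)//.
rewrite (ge0_integral_mscale m measurableT k mN)// [RHS]muleBr//.
by apply: fin_num_adde_defl; rewrite fin_numN.
Qed.

Lemma sum_dirac_setT_lty {R : realType} (s : seq (sphere R)) :
  (sum_dirac s setT < +oo)%E.
Proof.
rewrite /sum_dirac /msum; apply: lte_sum_pinfty => i _.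
by rewrite [X in (X < _)%E](diracT R (nth infty_pt s i)) ltry.
Qed.

(** * Equidistribution of forward orbits and invariance of the measure *)

Section Equilibrium.
Context {R : realType} (d : nat) (d_gt0 : (0 < d)%N).
Variables (rho : R) (f : nat -> R[i] -> R[i]).
Hypothesis rho_gt1 : 1 < rho.
Hypothesis f_le : forall i z, (i < d)%N -> normc (f i z) <= rho - 1.
Hypothesis f_contr : forall i z z', (i < d)%N -> normc z < rho ->
  normc z' < rho -> normc (f i z - f i z') <= normc (z - z') / 2.
Variable F : sphere R -> seq (sphere R).
Hypothesis F_branch : forall z, normc z < rho ->
  perm_eq (F (fin_pt z)) [seq fin_pt (f i z) | i <- iota 0 d].
Hypothesis F_escape : forall z, exists2 s, F (fin_pt z) = map (@fin_pt R) s &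
  size s = d /\ forall w, w \in s -> normc w <= normc z / 2 \/ normc w < rho.

Local Notation g := (coding d_gt0 rho_gt1 f_le f_contr).
Local Notation P := (uniform_prob (@ltr01 R)).
Local Notation compw := (branch_comp d f).
Local Notation mu := (coding_measure d_gt0 rho_gt1 f_le f_contr).
Local Notation gpt := (coding_pt d_gt0 rho_gt1 f_le f_contr).

Local Notation weak_limit := (coding_weak_limit (d_gt0 := d_gt0)
  (rho_gt1 := rho_gt1) (f_le := f_le) (f_contr := f_contr)).

Let f_lt i z : (i < d)%N -> normc (f i z) < rho.
Proof. by move=> /(f_le z)/le_lt_trans; apply; rewrite gtrBl. Qed.

Let normc0r : normc (0 : R[i]) < rho.
Proof. by rewrite normc0 (lt_trans ltr01). Qed.

Lemma sum_F_branch (phi : sphere R -> R) z : normc z < rho ->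
  \sum_(w <- F (fin_pt z)) phi w = \sum_(0 <= i < d) phi (fin_pt (f i z)).
Proof. by move=> /F_branch /(perm_big _) ->;
  rewrite big_map /index_iota subn0. Qed.

(** [mv_iter] recurses on the last step but [branch_comp] on the first, so the iterate is split as 1
    + m; the first branch is then the remainder of k modulo d. *)
Lemma sum_mv_iter_branch (phi : sphere R -> R) m b : normc b < rho ->
  \sum_(w <- mv_iter F m (fin_pt b)) phi w =
  \sum_(0 <= k < d ^ m) phi (fin_pt (compw m k b)).
Proof.
elim: m b => [|m IH] b br; first by rewrite expn0 big_nat1 big_seq1.
rewrite -add1n (sum_mv_iterD F phi) /= cats0.
rewrite (sum_F_branch (fun x => \sum_(w <- mv_iter F m x) phi w))//.
rewrite expnSr (big_nat_divmod _ (fun q i => phi (fin_pt (compw m q (f i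
  b)))))//.
rewrite exchange_big_nat/= big_nat [RHS]big_nat;
  apply: eq_bigr => i /andP[_ id].
by rewrite IH// f_lt.
Qed.

Lemma mv_iter_fin m a w :
  w \in mv_iter F m (fin_pt a) -> exists b, w = fin_pt b.
Proof.
elim: m w => [|m IH] w /=; first by rewrite inE => /eqP ->; exists a.
move=> /flattenP[_ /mapP[v /IH[b ->] ->]].
by have [s -> _] := F_escape b => /mapP[c _ ->]; exists c.
Qed.

Lemma size_mv_iter m a : size (mv_iter F m (fin_pt a)) = (d ^ m)%N.
Proof.
elim: m => [|m IH] //=; rewrite size_flatten /shape -map_comp expnSr -IH.
have : all (fun w => size (F w) == d) (mv_iter F m (fin_pt a)).
  apply/allP => w /mv_iter_fin[b ->]; have [s -> [<- _]] := F_escape b.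
  by rewrite size_map.
elim: (mv_iter F m (fin_pt a)) => //= x s IHs /andP[/eqP sx /IHs ->].
by rewrite sx mulSn.
Qed.

(** Each step halves the bound on the modulus or lands in the disk, so after k steps every point is
    below 2^(n - k) rho. Any integer n > |a| is a valid start, since n <= 2^n and rho > 1. *)
Lemma mv_iter_escape a : exists N, forall w, w \in mv_iter F N (fin_pt a) ->
  exists2 b, w = fin_pt b & normc b < rho.
Proof.
have [n an] : exists n : nat, normc a < 2 ^+ n * rho.
  exists (Num.truncn (normc a)).+1; apply: (lt_le_trans (truncnS_gt _)).
  apply: (@le_trans _ _ (2 ^+ (Num.truncn (normc a)).+1)).
    by rewrite -natrX ler_nat ltnW// ltn_expl.
  by rewrite ler_peMr ?exprn_ge0// ltW.
suff H k : (k <= n)%N -> forall w, w \in mv_iter F k (fin_pt a) ->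
    exists2 b, w = fin_pt b & normc b < 2 ^+ (n - k) * rho.
  exists n => w /(H _ (leqnn n))[b -> br]; exists b => //.
  by move: br; rewrite subnn expr0 mul1r.
elim: k => [_ w|k IH kn w] /=.
  by rewrite inE => /eqP ->; exists a; rewrite ?subn0.
move=> /flattenP[_ /mapP[v /(IH (ltnW kn))[b -> br] ->]].
have [s -> [_ sP]] := F_escape b => /mapP[c /sP cs ->]; exists c => //.
have p1 : 1 <= 2 ^+ (n - k.+1) :> R by rewrite exprn_ege1// ler1n.
case: cs => [cb|cr]; last by rewrite (lt_le_trans cr)// ler_peMl// ltW//
  (lt_trans ltr01).
apply: (le_lt_trans cb); rewrite ltr_pdivrMr// (lt_le_trans br)//.
by rewrite -(subnSK kn) exprSr mulrAC.
Qed.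

Lemma continuous_fin_pt : continuous (@fin_pt R : R[i]^o -> sphere R).
Proof. exact: one_point_compactification_some_continuous. Qed.

(** The sum is not divided by d, in accordance with the factor d in the invariance relation. *)
Definition branch_avg (phi : sphere R -> R) (z : R[i]) : R :=
  \sum_(0 <= i < d) phi (fin_pt (f i z)).

Lemma branch_avg_bounded phi (M : R) z :
  (forall x, `|phi x| <= M) -> `|branch_avg phi z| <= d%:R * M.
Proof.
move=> phiM; rewrite (le_trans (ler_norm_sum _ _ _))//.
rewrite (le_trans (ler_sum _ (fun i _ => phiM (fin_pt (f i z)))))//.
by rewrite big_const_nat subn0 iter_addr addr0 mulr_natl.
Qed.

Lemma branch_continuous i z : (i < d)%N -> normc z < rho ->
  {for (z : R[i]^o), continuous (f i : R[i]^o -> R[i]^o)}.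
Proof.
move=> id zr U /nbhs_complexP[e e0 He]; apply/nbhs_complexP.
exists (Num.min e (rho - normc z)); first by rewrite lt_min e0 subr_gt0.
move=> w; rewrite lt_min => /andP[we wr]; apply: He.
have wrho : normc w < rho by have := normcD (w - z) z; rewrite subrK; lra.
have := f_contr id wrho zr; have := normc_ge0 (w - z); lra.
Qed.

Lemma branch_avg_continuous phi z : continuous phi -> normc z < rho ->
  {for (z : R[i]^o), continuous (branch_avg phi : R[i]^o -> R)}.
Proof.
move=> cphi zr; rewrite /branch_avg.
have : forall i, i \in index_iota 0 d -> (i < d)%N by move=> i;
  rewrite mem_index_iota.
elim: (index_iota 0 d) => [|i s IH] sd.
  have -> : (fun z => \sum_(i <- [::]) phi (fin_pt (f i z))) = cst 0.
    by apply/funext => w; rewrite big_nil.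
  exact: (@cst_continuous R[i]^o R).
have -> : (fun z => \sum_(i <- i :: s) phi (fin_pt (f i z))) =
   (fun z => phi (fin_pt (f i z)) + \sum_(i <- s) phi (fin_pt (f i z))).
  by apply/funext => w; rewrite big_cons.
have h1 : {for (z : R[i]^o), continuous (fun z : R[i]^o => phi (fin_pt (f i z))
  : R)}.
  have h2 : {for (z : R[i]^o), continuous (f i : R[i]^o -> R[i]^o)}.
    by apply: branch_continuous => //; apply: sd; exact: mem_head.
  have h3 : {for (f i z : R[i]^o), continuous (@fin_pt R : R[i]^o -> sphere R)}.
    exact: continuous_fin_pt.
  exact: (continuous_comp (continuous_comp h2 h3) (@cphi _)).
have h4 := IH (fun j js => sd j (mem_behead (s := i :: s) js)).
exact: (@cvgD R R^o R[i]^o (nbhs (z : R[i]^o)) _ _ _ _ _ h1 h4).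
Qed.

Section TestFunction.
Variables (phi : sphere R -> R) (cphi : continuous phi).

Let I : R := fine (\int[P]_t (phi (gpt t))%:E).

Variable M : R.
Hypothesis phiM : forall x, `|phi x| <= M.

Let mphi : measurable_fun setT phi.
Proof. exact: continuous_sphere_measurable. Qed.

Let phi_comp_integrable : P.-integrable setT (EFin \o (phi \o gpt)).
Proof.
apply: measurable_bounded_integrable => //.
- by rewrite (le_lt_trans (probability_le1 _ _))// ltry.
- apply: measurableT_comp => //; exact: measurable_coding_pt.
- exists M; split; first by rewrite num_real.
  by move=> y My x _ /=; exact: le_trans (phiM _) (ltW My).
Qed.

Let IE : (\int[P]_t (phi (gpt t))%:E = I%:E)%E.
Proof. by rewrite fineK//;
  exact: (integrable_fin_num measurableT phi_comp_integrable). Qed.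

Lemma coding_integral : (\int[mu]_x (phi x)%:E = I%:E)%E.
Proof. by rewrite (coding_measure_integral _ _ _ _ mphi phiM). Qed.

Let cphi_fin : continuous (phi \o @fin_pt R : R[i]^o -> R).
Proof.
by move=> z; apply: continuous_comp; [exact: continuous_fin_pt|exact: cphi].
Qed.

Lemma mean_cvg_ball b : normc b < rho ->
  (d ^ m)%:R^-1 * \sum_(w <- mv_iter F m (fin_pt b)) phi w @[m --> \oo] --> I.
Proof.
move=> br; have := weak_limit br
  (fun z _ => @cphi_fin z) (fun z => phiM (fin_pt z)).
rewrite IE => /fine_cvgP[_].
have -> : (fun m => (d ^ m)%:R^-1 * \sum_(w <- mv_iter F m (fin_pt b)) phi w) =
    (fun m => (d ^ m)%:R^-1 * \sum_(0 <= k < d ^ m) phi (fin_pt (compw m k b))).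
  by apply/funext => m; rewrite sum_mv_iter_branch.
exact.
Qed.

(** Once all d^N points of the N-th iterate lie in the disk, the average at time n + N is the mean
    of d^N averages at time n started inside it, all with the same limit. *)
Lemma mean_cvg a :
  (d ^ m)%:R^-1 * \sum_(w <- mv_iter F m (fin_pt a)) phi w @[m --> \oo] --> I.
Proof.
have [N NP] := mv_iter_escape a; rewrite -(cvg_shiftn N).
have -> : [sequence (d ^ (n + N))%:R^-1 *
      \sum_(w <- mv_iter F (n + N) (fin_pt a)) phi w]_n =
    (fun n => (d ^ N)%:R^-1 * \sum_(b <- mv_iter F N (fin_pt a))
      ((d ^ n)%:R^-1 * \sum_(w <- mv_iter F n b) phi w)).
  apply/funext => n /=; rewrite addnC (sum_mv_iterD F phi).
  by rewrite expnD natrM invfM -mulrA mulr_sumr.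
have -> : I = (d ^ N)%:R^-1 * ((size (mv_iter F N (fin_pt a)))%:R * I).
  by rewrite size_mv_iter mulKf// pnatr_eq0 -lt0n expn_gt0 d_gt0.
apply: cvgMr; apply: cvg_sum_same_limit => w /NP[b -> br].
exact: mean_cvg_ball.
Qed.

End TestFunction.

(** The average at time m of the sum of phi over the branches is d times the average of phi at time
    m + 1. Both sides converge, so the limits satisfy the same relation. *)
Lemma integral_branch_avg (phi : sphere R -> R) (M : R) : continuous phi ->
  (forall x, `|phi x| <= M) ->
  (\int[P]_t (branch_avg phi (g t))%:E = d%:R%:E * \int[mu]_x (phi x)%:E)%E.
Proof.
move=> cphi phiM; rewrite (coding_integral cphi phiM).
have avgM z := branch_avg_bounded z phiM.
have h1 := weak_limit normc0r
  (fun z => branch_avg_continuous cphi (z := z)) avgM.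
have h2 := mean_cvg_ball cphi phiM normc0r.
rewrite -(cvg_shiftn 1) in h2.
set I := fine _ in h2 *.
have h3 : (fun m => (d ^ m)%:R^-1 * \sum_(0 <= k < d ^ m) branch_avg phi (compw
  m k 0))
    @ \oo --> d%:R * I.
  have -> : (fun m => (d ^ m)%:R^-1 *
        \sum_(0 <= k < d ^ m) branch_avg phi (compw m k 0)) =
      (fun m => d%:R * ((d ^ (m + 1))%:R^-1 *
        \sum_(w <- mv_iter F (m + 1) (fin_pt 0)) phi w)).
    apply/funext => m; rewrite addn1 sum_mv_iterS.
    rewrite (sum_mv_iter_branch (fun w => \sum_(v <- F w) phi v))//.
    rewrite expnS natrM invfM !mulrA mulfV ?pnatr_eq0 -?lt0n// mul1r.
    congr (_ * _); apply: eq_bigr => k _.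
    by rewrite sum_F_branch//; apply: (branch_comp_lt d_gt0 f_le).
  by apply: cvgMr; exact: h2.
rewrite -EFinM; apply: (cvg_unique (@ereal_hausdorff R) h1).
by apply: cvg_EFin; [exact: nearW|exact: h3].
Qed.

Lemma coding_weak_star a : weak_star_cvg
  (fun m => mscale ((d ^ m)%:R^-1)%:nng
              (sum_dirac (mv_iter F m (fin_pt a)))) mu.
Proof.
move=> phi cphi; have [M M0 phiM] := continuous_bounded_sphere cphi.
rewrite (coding_integral cphi phiM).
have -> : (fun m => \int[mscale (((d ^ m)%:R^-1)%:nng)%R
      (sum_dirac (mv_iter F m (fin_pt a)))]_z (phi z)%:E)%E =
   (fun m => ((d ^ m)%:R^-1 * \sum_(w <- mv_iter F m (fin_pt a)) phi w)%:E).
  apply/funext => m; rewrite (integral_mscale_bounded _ _ _ phiM).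
  - by rewrite integral_sum_dirac.
  - exact: sum_dirac_setT_lty.
  - exact: continuous_sphere_measurable.
apply: cvg_EFin; first exact: nearW.
exact: mean_cvg.
Qed.

Lemma coding_pushforward : is_pushforward F mu (mscale d%:R%:nng mu).
Proof.
move=> phi cphi; have [M M0 phiM] := continuous_bounded_sphere cphi.
have mphi := continuous_sphere_measurable cphi.
rewrite (integral_mscale_bounded _ _ mphi phiM); last first.
  by rewrite (le_lt_trans (probability_le1 _ _))// ltry.
rewrite -(integral_branch_avg cphi phiM).
pose B : set (sphere R) := [set fin_pt z | z in [set z | normc (z - 0) < rho]].
have oB : open B by exact: open_fin_ball.
(* Extension by 0 outside the disk gives a measurable substitute for the sum over F(z): it is
   continuous on the open disk, and the complement is null for the measure. *)
pose psi (x : sphere R) := if x is Some z then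
  if normc z < rho then branch_avg phi z else 0 else 0.
have mpsi : measurable_fun setT psi.
  apply: (measurability (@RGenOpens.G R)); first exact: RGenOpens.measurableE.
  move=> _ [_ [a [b ->] <-]]; rewrite setTI.
  have -> : psi @^-1` `]a, b[ =
      [set fin_pt z | z in [set z | normc z < rho /\ branch_avg phi z \in `]a,
        b[]] `|`
      (if 0 \in `]a, b[ then ~` B else set0).
    apply/seteqP; split=> [[z|]|x [[z [/= zr zab] <-]|]] /=.
    + rewrite /psi; case: ifPn => [zr zab|zr ->]; first by left; exists z.
      right; case=> w; rewrite /= subr0 => wr [wz].
      by move: zr; rewrite -wz wr.
    + by rewrite /psi => ->; right; case.
    + by rewrite /psi zr.
    case: ifP => // ab xB; rewrite /psi.
    move: x xB => [z|//] xB; case: ifPn => // zr.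
    by case: xB; exists z => //=; rewrite subr0.
  apply: measurableU; last first.
    by case: ifP => _ //; apply: measurableC; exact: open_sphere_measurable.
  apply: open_sphere_measurable; apply: one_point_compactification_open_some.
  rewrite openE => z /= [zr zab].
  have h : nbhs (branch_avg phi z) [set` `]a, b[].
    by apply: open_nbhs_nbhs; split=> //; exact: interval_open.
  have /nbhs_complexP[e e0 He] := branch_avg_continuous cphi zr h.
  apply/nbhs_complexP; exists (Num.min e (rho - normc z)).
    by rewrite lt_min e0 subr_gt0.
  move=> w; rewrite lt_min => /andP[we wr]; split; last exact: He.
  by have := normcD (w - z) z; rewrite subrK; lra.
have -> : (\int[mu]_z (\sum_(w <- F z) phi w)%:E = \int[mu]_z (psi z)%:E)%E.
  apply: (@integral_off_null _ _ _ _ (~` B)).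
  - by apply: measurableC; exact: open_sphere_measurable.
  - change (P (gpt @^-1` (~` B)) = 0%E).
    rewrite (_ : _ @^-1` _ = set0) ?measure0//.
    apply/seteqP; split=> // t /=; apply; exists (g t) => //=.
    by rewrite subr0; exact: coding_lt.
  - move=> x /contrapT[z /=]; rewrite subr0 => zr <- /=.
    by rewrite zr sum_F_branch.
rewrite (coding_measure_integral _ _ _ _ mpsi (M := d%:R * M)).
  by apply: eq_integral => t _ /=; rewrite coding_lt.
move=> [z|] /=; last by rewrite normr0 mulr_ge0.
by case: ifP => _; [exact: branch_avg_bounded|rewrite normr0 mulr_ge0].
Qed.

End Equilibrium.

(** * Support and regularity *)

Lemma closed_msupport {R : realType} (mu : {measure set (sphere R) -> \bar R}) :
  closed (msupport mu).
Proof.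
rewrite -[X in closed X]setCK; apply: open_closedC; rewrite openE => x xS.
have [U [oU Ux muU]] : exists U, [/\ open U, U x & ~ (0 < mu U)%E].
  apply: contrapT => H; apply: xS => U oU Ux; apply: contrapT => muU.
  by apply: H; exists U.
rewrite /interior /= nbhsE; exists U; first by split.
by move=> y Uy /(_ U oU Uy).
Qed.

Section Support.
Context {R : realType} (d : nat) (d_gt0 : (0 < d)%N).
Variables (rho : R) (f : nat -> R[i] -> R[i]).
Hypothesis rho_gt1 : 1 < rho.
Hypothesis f_le : forall i z, (i < d)%N -> normc (f i z) <= rho - 1.
Hypothesis f_contr : forall i z z', (i < d)%N -> normc z < rho ->
  normc z' < rho -> normc (f i z - f i z') <= normc (z - z') / 2.

Local Notation g := (coding d_gt0 rho_gt1 f_le f_contr).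
Local Notation gP := (codingP d_gt0 rho_gt1 f_le f_contr).
Local Notation P := (uniform_prob (@ltr01 R)).
Local Notation compw := (branch_comp d f).
Local Notation mu := (coding_measure d_gt0 rho_gt1 f_le f_contr).
Local Notation gpt := (coding_pt d_gt0 rho_gt1 f_le f_contr).

Let normc0r : normc (0 : R[i]) < rho.
Proof. by rewrite normc0 (lt_trans ltr01). Qed.

(** Composing with a branch on the outside amounts to prepending a most significant digit. Forward
    invariance of the support rests on this. *)
Lemma branch_comp_cons i m k z : (i < d)%N -> (k < d ^ m)%N ->
  exists2 k', (k' < d ^ m.+1)%N & compw m.+1 k' z = f i (compw m k z).
Proof.
move=> id; elim: m k z => [|m IH] k z km.
  by exists i; rewrite ?expn1//= modn_small.
have kd : (k %/ d < d ^ m)%N by rewrite ltn_divLR// -expnSr.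
have [k' k'm E] := IH (k %/ d)%N (f (k %% d) z) kd.
exists (k' * d + k %% d)%N; last first.
  rewrite -[LHS]/(compw m.+1 ((k' * d + k %% d) %/ d) (f ((k' * d + k %% d) %%
    d) z)).
  by rewrite divnMDl// [(k %% d %/ d)%N]divn_small ?ltn_mod// addn0 modnMDl
    modn_mod E.
rewrite [(d ^ m.+2)%N]expnSr; apply: (@leq_trans (k'.+1 * d)).
  by rewrite mulSn addnC ltn_add2r ltn_mod.
by rewrite leq_mul2r k'm orbT.
Qed.

Lemma msupport_meets x (U : set (sphere R)) : msupport mu x -> nbhs x U ->
  exists t, U (gpt t).
Proof.
move=> xS; rewrite nbhsE => -[V [oV Vx] VU]; have := xS V oV Vx.
apply: contraPP => H; change (~ (0 < P (gpt @^-1` V))%E).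
rewrite (_ : _ @^-1` _ = set0) ?measure0 ?ltxx//.
by apply/seteqP; split=> // t Vt; apply: H; exists t; exact: VU.
Qed.

(** With [approx_msupport] this describes the support, without reference to the measure, by limits
    of compositions applied to 0 along words of unbounded length. *)
Lemma msupport_approx z (e : R) N : msupport mu (fin_pt z) -> 0 < e ->
  exists m k, [/\ (N <= m)%N, (k < d ^ m)%N & normc (compw m k 0 - z) < e].
Proof.
move=> zS e0; have e2 : 0 < e / 2 by rewrite divr_gt0.
have [|t [w /= wz [wt]]] := msupport_meets zS (U := [set fin_pt w | w in [set w
  | normc (w - z) < e / 2]]).
  apply: open_nbhs_nbhs; split; first exact: open_fin_ball.
  by exists z => //=; rewrite subrr normc0.
have [n nP] := coding_rate_small rho e2.
exists (maxn N n), (word d (maxn N n) t); split;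
  [exact: leq_maxl|exact: word_lt|].
have := gP t (maxn N n) normc0r; have := nP _ (leq_maxr N n).
have := normc_triangle (g t) (compw (maxn N n) (word d (maxn N n) t) 0) z.
by rewrite [normc (_ - g t)]normcB -wt; lra.
Qed.

(** The parameters with a given word of length m have mass d^(-m) > 0, and for large m the coding
    sends all of them close to the composition along that word. *)
Lemma approx_msupport z :
  (forall (e : R) N, 0 < e ->
    exists m k, [/\ (N <= m)%N, (k < d ^ m)%N & normc (compw m k 0 - z) < e]) ->
  msupport mu (fin_pt z).
Proof.
move=> H U oU Uz; have /nbhs_finP[e e0 He] : nbhs (fin_pt z) U.
  by apply: open_nbhs_nbhs; split.
have e2 : 0 < e / 2 by rewrite divr_gt0.
have [n nP] := coding_rate_small rho e2.
have [m [k [nm km kz]]] := H _ n e2.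
apply: (@lt_le_trans _ _ (P [set t | word d m t = k])).
  by rewrite prob_word// lte_fin invr_gt0 ltr0n expn_gt0 d_gt0.
change (P [set t | word d m t = k] <= P (gpt @^-1` U))%E.
apply: le_measure; rewrite ?inE.
- exact: (measurable_word d_gt0 m [set j | j = k]).
- rewrite -[X in measurable X]setTI; apply: measurable_coding_pt => //.
  exact: open_sphere_measurable.
- move=> t /= tk; apply: He.
  have := gP t m normc0r; have := nP _ nm; rewrite tk.
  by have := normc_triangle (compw m k 0) (g t) z; lra.
Qed.

Lemma coding_in_msupport t : msupport mu (gpt t).
Proof.
apply: approx_msupport => e N e0; have [n nP] := coding_rate_small rho e0.
exists (maxn N n), (word d (maxn N n) t); split;
  [exact: leq_maxl|exact: word_lt|].
by rewrite normcB; apply: le_lt_trans (gP _ _ normc0r) (nP _ (leq_maxr _ _)).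
Qed.

Lemma msupport_near_branch x : msupport mu x ->
  exists2 z, x = fin_pt z & forall e, 0 < e ->
    exists i z', [/\ (i < d)%N, normc z' < rho & normc (z - f i z') < e].
Proof.
case: x => [z|] xS; last first.
  (* Infinity is excluded because the coding stays in the disk. *)
  have [t] := msupport_meets xS (nbhs_infty rho).
  case; exists (g t) => //=; exact/ltW/coding_lt.
exists z => // e e0; have e2 : 0 < e / 2 by rewrite divr_gt0.
(* Length at least 1 guarantees an outermost branch. *)
have [m [k [m1 km kz]]] := msupport_approx 1 xS e2.
case: m m1 km kz => // m _ km kz.
have [i [z' [id z'r E]]] := branch_comp_head d_gt0 f_le normc0r km.
by exists i, z'; split=> //; rewrite -E normcB; lra.
Qed.

Lemma msupport_lt z : msupport mu (fin_pt z) -> normc z < rho.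
Proof.
move=> /msupport_near_branch[_ [<-] /(_ 1 ltr01)[i [z' [id z'r E]]]].
by have := normcD (z - f i z') (f i z'); rewrite subrK; have := f_le z' id; lra.
Qed.

Lemma msupport_branch i z : (i < d)%N -> msupport mu (fin_pt z) ->
  msupport mu (fin_pt (f i z)).
Proof.
move=> id zS; apply: approx_msupport => e N e0.
have [m [k [Nm km kz]]] := msupport_approx N zS e0.
have [k' k'm E] := branch_comp_cons 0 id km.
exists m.+1, k'; split=> //; first exact: leqW.
rewrite E; have := f_contr id (branch_comp_lt d_gt0 f_le m k normc0r)
  (msupport_lt zS).
by have := normc_ge0 (compw m k 0 - z); lra.
Qed.

(** Words started at b stay in S, and by contraction long words have nearly the same value at b as
    at 0; so S comes arbitrarily close to every point of the support. *)
Lemma msupport_minimal (S : set (sphere R)) b : closed S ->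
  (forall i z, (i < d)%N -> normc z < rho ->
    S (fin_pt z) -> S (fin_pt (f i z))) ->
  normc b < rho -> S (fin_pt b) -> msupport mu `<=` S.
Proof.
move=> cS SF br Sb x xS; have [z xE _] := msupport_near_branch xS; subst x.
have Scomp m k c : normc c < rho -> S (fin_pt c) -> S (fin_pt (compw m k c)).
  elim: m k c => //= m IH k c cr Sc.
  have kd : (k %% d < d)%N by rewrite ltn_mod.
  apply: IH; last exact: SF.
  by rewrite (le_lt_trans (f_le c kd))// gtrBl.
apply: cS => U /nbhs_finP[e e0 He]; have e2 : 0 < e / 2 by rewrite divr_gt0.
have [n nP] := coding_rate_small rho e2.
have [m [k [nm km kz]]] := msupport_approx n xS e2.
exists (fin_pt (compw m k b)); split; first exact: Scomp.
apply: He; apply: le_lt_trans (normc_triangle (compw m k 0) _ _) _.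
have := branch_comp_contraction d_gt0 f_le f_contr m k br normc0r.
have h : normc (b - 0) / 2 ^+ m <= 6 * rho / 2 ^+ m.
  by rewrite ler_pM2r ?invr_gt0 ?exprn_gt0// subr0; move: rho_gt1; lra.
by have := nP _ nm; lra.
Qed.

(** Off the d-adic rationals the first m digits are locally constant, and they determine the coding
    up to twice the error radius. *)
Lemma coding_continuous t : ~ dadic d t ->
  {for t, continuous (gpt : R -> sphere R)}.
Proof.
move=> tD U /nbhs_finP[e e0 He]; have e2 : 0 < e / 2 by rewrite divr_gt0.
have [m mP] := coding_rate_small rho e2.
have := word_locally_constant d_gt0 m tD.
rewrite !near_simpl => H; near=> s; apply: He.
have ws : word d m s = word d m t by near: s.
have := gP s m normc0r; have := gP t m normc0r; rewrite ws;
  have := mP _ (leqnn m).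
have := normc_triangle (compw m (word d m t) 0) (g s) (g t).
by rewrite [normc (compw _ _ _ - g t)]normcB; lra.
Unshelve. all: by end_near. Qed.

(** The compact set is the image of a compact set of parameters on which the coding is continuous;
    its preimage contains those parameters, so no mass is lost. *)
Lemma coding_inner_regular (A : set (sphere R)) (e : R) :
  measurable A -> 0 < e ->
  exists K, [/\ compact K, K `<=` A & (mu A <= mu K + e%:E)%E].
Proof.
move=> mA e0; have mgA : measurable (gpt @^-1` A).
  by rewrite -[X in measurable X]setTI; apply: measurable_coding_pt.
have [K [cK KA KD Ke]] := uniform_prob_inner_regular d mgA e0.
have cgK : compact ((gpt : R -> sphere R) @` K).
  apply: continuous_compact => //; apply: continuous_in_subspaceT => t.
  by rewrite inE => /KD; exact: coding_continuous.
have mK : measurable (K : set (measurableTypeR R)) by exact: compact_measurable.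
exists (gpt @` K); split=> //; first by move=> _ [t /KA At <-].
have mgK : measurable (gpt @` K).
  by apply: closed_sphere_measurable;
    exact: compact_closed (@sphere_hausdorff R) cgK.
change (P (gpt @^-1` A) <= P (gpt @^-1` (gpt @` K)) + e%:E)%E.
have mpK : measurable (gpt @^-1` (gpt @` K)).
  by rewrite -[X in measurable X]setTI; apply: measurable_coding_pt.
apply: (@le_trans _ _ (P K + P (gpt @^-1` A `\` K))%E).
  apply: le_trans (measureU2 _ _ _) => //; last exact: measurableD.
  apply: le_measure; rewrite ?inE//; first by apply: measurableU => //;
    exact: measurableD.
  by move=> t At; have [Kt|Kt] := pselect (K t); [left|right].
apply: leeD; last exact: ltW.
by apply: le_measure; rewrite ?inE// => t Kt; exists t.
Qed.

(** Complement of a compact set approximating the complement of A from inside, the total mass being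
    1. *)
Lemma coding_outer_regular (A : set (sphere R)) (e : R) :
  measurable A -> 0 < e ->
  exists U, [/\ open U, A `<=` U & (mu U <= mu A + e%:E)%E].
Proof.
move=> mA e0.
have [K [cK KA Ke]] := coding_inner_regular (measurableC mA) e0.
have clK : closed K by exact: compact_closed (@sphere_hausdorff R) cK.
exists (~` K); split; first exact: closed_openC.
  by move=> x Ax /KA.
have mK := closed_sphere_measurable clK.
move: Ke; rewrite !probability_setC//.
have : mu A \is a fin_num by exact: fin_num_measure.
have : mu K \is a fin_num by exact: fin_num_measure.
case: (mu K) => // k _; case: (mu A) => // a _.
by rewrite -!EFinB -!EFinD !lee_fin; lra.
Qed.

Lemma coding_regular : regular_measure mu.
Proof.
move=> A mA; split; apply/eqP; rewrite eq_le; apply/andP; split.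
- apply: le_ereal_inf_tmp => _ [U [oU AU] <-].
  by apply: le_measure; rewrite ?inE//; exact: open_sphere_measurable.
- apply/lee_addgt0Pr => e e0; have [U [oU AU Ue]] := coding_outer_regular mA e0.
  by apply: le_trans Ue; apply: ereal_inf_lbound; exists U.
- apply/lee_addgt0Pr => e e0; have [K [cK KA Ke]] := coding_inner_regular mA e0.
  by apply: le_trans Ke _; apply: leeD => //; apply: ereal_sup_ubound; exists K.
- apply: ge_ereal_sup => _ [K [cK KA] <-].
  apply: le_measure; rewrite ?inE//; apply: closed_sphere_measurable.
  exact: compact_closed (@sphere_hausdorff R) cK.
Qed.

End Support.

Theorem theorem1 (R : realType) (d : nat) (R0 : {poly R[i]})
    (P : {poly {poly R[i]}})
    (d_ge1 : (1 <= d)%N)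
    (degR0 : size R0 = d.+1)
    (simpleR0 : forall r : R[i], root R0 r -> mup r R0 = 1%N)
    (degP : total_degree_le P d)
    (eps : R) (eps_gt0 : 0 < eps) :
  exists2 Delta : R, 0 < Delta &
    forall delta : R, 0 <= delta -> `|delta| < Delta ->
    let G := corr_family R0 P delta in
    let F := corr_mult G in
    exists mu : probability (sphere R) R,
      [/\ regular_measure mu,
          is_pushforward F mu (mscale d%:R%:nng mu),
          forall a : R[i],
            weak_star_cvg
              (fun m : nat =>
                 mscale ((d ^ m)%:R^-1)%:nng
                   (sum_dirac (mv_iter F m (fin_pt a))))
              mu,
          msupport mu `<=` zeros_nbhd R0 eps &
          minimal_set
            (fun S : set (sphere R) =>
               [/\ closed S, forward_invariant G S &
                   exists a : R[i], S (fin_pt a)])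
            (msupport mu)].
Proof.
have [rho [Delta [rho_gt1 Delta_gt0 H]]] :=
  contracting_branches degR0 simpleR0 degP eps_gt0.
exists Delta => // delta delta_ge0 delta_lt G F.
have [f [f_near f_contr F_branch F_fin G_escape]] := H delta delta_ge0 delta_lt.
have f_le i z (id : (i < d)%N) := (f_near i z id).1.
have F_escape z : exists2 s, F (fin_pt z) = map (@fin_pt R) s &
    size s = d /\ forall w, w \in s -> normc w <= normc z / 2 \/ normc w < rho.
  have [s Fs [sd sP]] := F_fin z; exists s => //; split=> // w.
  by rewrite sP => /eqP; exact: G_escape.
have root_corr z w : G.[z, w] = 0 -> corr G (fin_pt z) (fin_pt w).
  exact: graph_root.
have root_branch i z : (i < d)%N -> normc z < rho -> G.[z, f i z] = 0.
  move=> id zr; have [s Fs [sd sP]] := F_fin z.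
  have : fin_pt (f i z) \in F (fin_pt z).
    rewrite (perm_mem (F_branch z zr)); apply/mapP; exists i => //.
    by rewrite mem_iota.
  by rewrite /F Fs => /mapP[w ws [->]]; apply/eqP; rewrite -sP.
have branch_of_root z w : normc z < rho -> G.[z, w] = 0 ->
    exists2 i, (i < d)%N & w = f i z.
  move=> zr Gzw; have [s Fs [sd sP]] := F_fin z.
  have : fin_pt w \in F (fin_pt z).
    by rewrite /F Fs map_f// sP Gzw.
  rewrite (perm_mem (F_branch z zr)) => /mapP/=[i +];
    rewrite mem_iota => id [->].
  by exists i.
exists (coding_measure d_ge1 rho_gt1 f_le f_contr); split.
- exact: coding_regular.
- exact: coding_pushforward.
- by move=> a; exact: coding_weak_star.
- move=> x /msupport_near_branch[z -> zP].
  (* Half of eps pays for the limit, the other half for the distance from a branch value to its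
     zero. *)
  have [i [z' [id z'r zz']]] := zP _ (divr_gt0 eps_gt0 (ltr0n R 2)).
  have [_ [r rr fr]] := f_near i z' id.
  exists z => //=; exists r => //; rewrite normrCE ltcR.
  by have := normc_triangle (f i z') z r; lra.
split.
- by exists (coding_pt d_ge1 rho_gt1 f_le f_contr 0); exact: coding_in_msupport.
- split; first exact: closed_msupport.
    (* The support lies in the disk, where the closed graph contains only true roots and every root
       is a branch value. *)
    move=> w [x xS]; have [z xE _] := msupport_near_branch xS; subst x.
    rewrite /corr /= => /graph_fin[|w' -> Gzw']; first by exists rho.
    have [i id ->] := branch_of_root _ _ (msupport_lt xS) Gzw'.
    exact: msupport_branch.
  by exists (coding d_ge1 rho_gt1 f_le f_contr 0); exact: coding_in_msupport.
move=> S [cS iS [a Sa]].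
have SG z w : S (fin_pt z) -> G.[z, w] = 0 -> S (fin_pt w).
  by move=> Sz Gzw; apply: iS; exists (fin_pt z) => //; exact: root_corr.
(* The forward orbit of a stays in S and enters the disk by time N; a point b exists because the
   N-th iterate has d^N > 0 entries. *)
have [b br Sb] : exists2 b, normc b < rho & S (fin_pt b).
  have Sit m w : w \in mv_iter F m (fin_pt a) -> S w.
    elim: m w => [|m IH] w /=; first by rewrite inE => /eqP ->.
    move=> /flattenP[_ /mapP[v vF ->]]; have [c vE] := mv_iter_fin F_escape vF.
    have [s Fs [_ sP]] := F_fin c; rewrite vE /F Fs => /mapP[u us ->].
    by apply: (SG c); [rewrite -vE; exact: IH|apply/eqP; rewrite -sP].
  have [N NP] := mv_iter_escape rho_gt1 F_escape a.
  have := size_mv_iter F_escape N a.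
  case: (mv_iter F N (fin_pt a)) NP (Sit N) => [|w s] NP SN sz.
    by move: sz => /= /esym/eqP; rewrite expn_eq0 -leqn0 leqNgt d_ge1.
  by have [b wb br] := NP w (mem_head _ _); exists b => //; rewrite -wb;
    apply/SN/mem_head.
apply: (@msupport_minimal _ _ _ _ _ _ _ _ S b) => // i z id zr Sz.
by apply: (SG z) => //; exact: root_branch.
Qed.
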